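(* Let $H$ be a separable (real) Hilbert space. Then $\mathcal{Q}^H_{2,2}$ and $\mathcal{W}_2$ are topologically equivalent distances on $\mathcal{P}_2(H)$.
   Context: $H$ (finite- or infinite-dimensional) has inner product $(\cdot\mid\cdot)$ and induced norm $|\cdot|$. $\mathcal{P}_2(H)$ is the set of Borel probability measures $\mu$ on $H$ with $\int_H|\xi|^2\mu(d\xi)<+\infty$, and $\mathcal{W}_2$ is the $L^2$-Wasserstein distance. For $\mu\in\mathcal{P}_2(H)$ and $(a,b)\in H^2$, $e_{2,2}(\mu,(a,b))=\big[\int_H\min(|\xi-a|^2,|\xi-b|^2)\,\mu(d\xi)\big]^{1/2}$. For $\mu,\nu\in\mathcal{P}_2(H)$, $\mathcal{Q}^H_{2,2}(\mu,\nu)=\sup_{(a,b)\in H^2}|e_{2,2}(\mu,(a,b))-e_{2,2}(\nu,(a,b))|\in[0,+\infty)$. Two distances are topologically equivalent if they induce the same topology. *)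

(* Defs.v *)
From HB Require Import structures.
From mathcomp Require Import all_boot all_order all_algebra.
From mathcomp Require Import all_classical all_reals all_analysis.
From mathcomp Require Import giry.

Set Implicit Arguments.
Unset Strict Implicit.
Unset Printing Implicit Defensive.

Import Order.TTheory GRing.Theory Num.Theory.
Import numFieldNormedType.Exports.

Local Open Scope classical_set_scope.
Local Open Scope ring_scope.

Definition separable (T : topologicalType) : Prop :=
  exists2 D : set T, countable D & dense D.

Definition borel (T : ptopologicalType) : measurableType (@open T).-sigma :=
  g_sigma_algebraType (@open T).

(* Library measures are total on [set T], so two records denote the same Borel
   measure exactly when they agree on measurable sets ([measure_eq]). *)
Record P2 (R : realType) (H : normedModType R) := MkP2 {
  P2_prob :> probability (borel H) R ;
  P2_moment : (\int[P2_prob]_x (`|x : H| ^+ 2)%:E < +oo)%E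
}.

Section distances.
Context (R : realType) (H : normedModType R).
Implicit Types mu nu : P2 H.

Definition P2_eq mu nu : Prop := measure_eq mu nu.

Definition e22 mu (a b : H) : R :=
  Num.sqrt (\int[mu]_x Num.min (`|(x : H) - a| ^+ 2) (`|(x : H) - b| ^+ 2)).

Definition Q22 mu nu : \bar R :=
  ereal_sup [set `|e22 mu ab.1 ab.2 - e22 nu ab.1 ab.2|%:E
            | ab in [set: H * H]].

(* A measure for the product of the two Borel sigma-algebras; when [H] is
   separable this is the Borel sigma-algebra of the product space. *)
Definition coupling mu nu
    (pi : probability (borel H * borel H)%type R) : Prop :=
  (forall A, measurable A -> pi (A `*` setT) = mu A) /\
  (forall B, measurable B -> pi (setT `*` B) = nu B).

Definition W2 mu nu : \bar R :=
  sqrte (ereal_inf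
    [set (\int[pi]_z (`|(z.1 : H) - (z.2 : H)| ^+ 2)%:E)%E
    | pi in coupling mu nu]).

End distances.

(* [eqT] plays the role of equality of points. *)
Record is_distance (R : realType) (T : Type) (eqT : T -> T -> Prop)
    (d : T -> T -> \bar R) : Prop := IsDistance {
  distance_ge0 : forall x y, (0 <= d x y)%E ;
  distance_lty : forall x y, (d x y < +oo)%E ;
  distance_eq0 : forall x y, d x y = 0%E <-> eqT x y ;
  distance_sym : forall x y, d x y = d y x ;
  distance_triangle : forall x y z, (d x z <= d x y + d y z)%E
}.

Definition distance_open (R : realType) (T : Type) (d : T -> T -> \bar R) :
    set (set T) :=
  [set U | forall x, U x ->
    exists2 r : R, 0 < r & [set y | (d x y < r%:E)%E] `<=` U].

Definition topologically_equivalent (R : realType) (T : Type)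
    (d1 d2 : T -> T -> \bar R) : Prop :=
  distance_open d1 = distance_open d2.

(* Main.v *)
(** Let the functions [e22 nu] converge pointwise to [e22 mu].  Expanding
    [min (|x - a|^2, |x - b|^2)] shows that the integrals of [|x|^2] and of the hinges
    [max (<x,v> - t, 0)] converge, hence, by piecewise linear interpolation,
    those of [cos (<x,w> + th)] and of all trigonometric polynomials.

    Products of factors [(1 +- sin <x,w>) / 2] form a finite partition of unity
    [phi_i] by trigonometric polynomials.  Viewing [phi_i x] as the probability
    that a sum of independent signed steps ends in [c_i], the cost
    [sum_i phi_i x |x - c_i|^2] splits into a squared bias and a variance.  Steps
    along an orthonormal basis make its [mu]-integral as small as desired, and
    this integral is continuous along the limit because [|x|^2], [phi_i] and
    [<x,c_i> phi_i] are test functions.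

    Measures giving nearly the same mass to every [phi_i] are coupled, cell by
    cell, by a density on the product measure; its cost is controlled by the cell
    sizes, so [W2 mu nu] is small.  The same gluing along a fine partition
    replaces disintegration in the triangle inequality for [W2]. *)

From HB Require Import structures.
Require Import Defs.
From mathcomp Require Import all_boot all_order all_algebra.
From mathcomp Require Import all_classical all_reals all_analysis.
From mathcomp Require Import measurable_realfun ring lra.
Set Implicit Arguments.
Unset Strict Implicit.
Unset Printing Implicit Defensive.
Import Order.TTheory GRing.Theory Num.Theory.
Import numFieldNormedType.Exports.
Local Open Scope classical_set_scope.
Local Open Scope ring_scope.

(** In infinite dimension bounded sets are not relatively compact, so pointwise convergence of
    characteristic functions alone does not give weak convergence. What replaces compactness is
    convergence of the integral of |x|^2: it makes the cost of one finite partition a test function,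
    so that a cost small for [mu] stays small for nearby measures, tails and neglected directions
    included.

    The cells are soft because sharp indicators are not continuous, while sine factors are
    continuous and their products are linearized by product-to-sum formulas. A soft cell need not
    have small diameter; it is small in mean square, which is all that a quadratic cost sees. Since
    a sine is bounded, a coordinate t = <x,e> is reached only as L sin (t / L) with L large.

    Convergence is taken along an arbitrary filter. For the filter of [Q22]-balls it gives the hard
    inclusion of topologies; for the filter concentrated at one measure it shows that a vanishing
    [Q22] forces a vanishing [W2]. The easy inclusion is quantitative: [e22] is the L^2 norm of a
    1-Lipschitz function, so [Q22] is at most [W2]. *)

(** * Probability measures given by a density *)

Section density.
Local Open Scope ereal_scope.
Context d (T : measurableType d) (R : realType).
Variables (P : {measure set T -> \bar R}) (g : T -> R).
Hypotheses (mg : measurable_fun [set: T] g) (g0 : forall x, (0 <= g x)%R).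

Let mgE : measurable_fun [set: T] (EFin \o g).
Proof. exact/measurable_EFinP. Qed.

Let dens (A : set T) : \bar R := \int[P]_(x in A) (g x)%:E.

Let dens0 : dens set0 = 0. Proof. exact: integral_set0. Qed.

Let dens_ge0 A : 0 <= dens A.
Proof. by apply: integral_ge0 => x _; rewrite lee_fin. Qed.

Let dens_sigma_additive : semi_sigma_additive dens.
Proof.
move=> F mF tF mUF; rewrite /dens; apply: cvg_toP.
  apply: ereal_nondecreasing_is_cvgn => m n mn.
  by apply: lee_sum_nneg_natr => // k _ _; exact: dens_ge0.
rewrite ge0_integral_bigcup//=; first exact: measurable_funTS.
by move=> x _; rewrite lee_fin.
Qed.

Hypothesis g1 : \int[P]_x (g x)%:E = 1.

Import HBNNSimple.

(** The integral formula holds on simple functions by linearity and reaches nonnegative [f] by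
    monotone convergence on both sides. *)
Lemma density_probability : exists G : probability T R,
  (forall A, measurable A -> G A = \int[P]_(x in A) (g x)%:E) /\
  (forall f : T -> \bar R, measurable_fun [set: T] f -> (forall x, 0 <= f x) ->
    \int[G]_x f x = \int[P]_x (f x * (g x)%:E)).
Proof.
pose m : {measure set T -> \bar R} :=
  HB.pack dens (isMeasure.Build _ _ _ dens dens0 dens_ge0 dens_sigma_additive).
pose G : probability T R :=
  HB.pack dens (isMeasure.Build _ _ _ dens dens0 dens_ge0 dens_sigma_additive)
    (Measure_isProbability.Build _ _ _ m g1).
exists G; split=> // f mf f0.
pose f_ := nnsfun_approx measurableT mf.
transitivity (limn (fun n => \int[G]_x (f_ n x)%:E)).
  rewrite -monotone_convergence//.
  - apply: eq_integral => y _; apply/esym/cvg_lim => //.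
    by apply: cvg_nnsfun_approx => // *; exact: f0.
  - by move=> n; exact/measurable_EFinP/measurable_funP.
  - by move=> n y _; rewrite lee_fin.
  - by move=> y _ i n mn; rewrite lee_fin; exact/lefP/nd_nnsfun_approx.
rewrite [X in limn X](_ : _ = (fun n => \int[P]_x ((f_ n x)%:E * (g x)%:E))).
  rewrite -monotone_convergence//; last 3 first.
  - by move=> n /=; apply: emeasurable_funM => //; exact/measurable_EFinP/measurable_funP.
  - by move=> n x _ /=; rewrite mule_ge0// lee_fin.
  - move=> x _ i n mn; rewrite lee_wpmul2r// lee_fin//.
    exact/lefP/nd_nnsfun_approx.
  apply: eq_integral => x _; apply/cvg_lim => //.
  by apply: cvgeZr => //; apply: cvg_nnsfun_approx => // *; exact: f0.
apply/funext => n.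
transitivity (\sum_(k \in range (f_ n))
    \int[P]_x ((k * \1_(f_ n @^-1` [set k]) x)%:E * (g x)%:E)).
  under eq_integral do rewrite fimfunE -fsumEFin//.
  rewrite ge0_integral_fsum//; last 2 first.
  - by move=> y; exact/measurable_EFinP/measurable_funM.
  - by move=> y x _; rewrite nnfun_muleindic_ge0.
  apply: eq_fsbigr => r _; rewrite integralZl_indic_nnsfun// integral_indic//=.
  rewrite setIT.
  transitivity (r%:E * \int[P]_x ((g x)%:E * (\1_(f_ n @^-1` [set r]) x)%:E)).
    congr (_ * _); rewrite /m /=/dens.
    rewrite integral_mkcond; apply: eq_integral => x _.
    by rewrite patchE indicE; case: ifP; rewrite ?mule1 ?mule0.
  (* Membership of [r] in the range was dropped, so a negative [r] is possible here; its preimage is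
     empty and both sides vanish. *)
  have [r0|r0] := ltP r 0%R.
    rewrite preimage_nnfun0// !integral0_eq ?mule0// => x _.
      by rewrite indic0 mulr0 mul0e.
    by rewrite indic0 mule0.
  rewrite -ge0_integralZl//.
  - by apply: eq_integral => x _; rewrite EFinM -muleA; congr (_ * _); rewrite muleC.
  - by apply: emeasurable_funM => //; exact/measurable_EFinP.
  - by move=> x _; rewrite mule_ge0 ?lee_fin.
rewrite -ge0_integral_fsum//.
- apply: eq_integral => x _; rewrite (fimfunE (f_ n)) -fsumEFin//.
  by rewrite ge0_mule_fsuml// => r; rewrite nnfun_muleindic_ge0.
- move=> r; apply: emeasurable_funM => //.
  exact/measurable_EFinP/measurable_funM.
- by move=> r x _; rewrite mule_ge0 ?lee_fin// -lee_fin nnfun_muleindic_ge0.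
Qed.

End density.

Section product_integral.
Local Open Scope ereal_scope.
Context d1 d2 (T1 : measurableType d1) (T2 : measurableType d2) (R : realType).
Variables (P1 : probability T1 R) (P2 : probability T2 R).

Lemma integral_prodM (a : T1 -> R) (b : T2 -> R) :
  measurable_fun [set: T1] a -> measurable_fun [set: T2] b ->
  (forall x, (0 <= a x)%R) -> (forall y, (0 <= b y)%R) ->
  \int[P1 \x P2]_z (a z.1 * b z.2)%:E =
  \int[P1]_x (a x)%:E * \int[P2]_y (b y)%:E.
Proof.
move=> ma mb a0 b0; rewrite fubini_tonelli1 //=; last 2 first.
- apply/measurable_EFinP; apply: measurable_funM.
    exact: measurableT_comp.
  exact: measurableT_comp.
- by move=> z; rewrite lee_fin mulr_ge0.
transitivity (\int[P1]_x ((a x)%:E * \int[P2]_y (b y)%:E)).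
  apply: eq_integral => x _; rewrite /fubini_F /=.
  rewrite -ge0_integralZl//.
  - by apply/measurable_EFinP.
  - by move=> y _; rewrite lee_fin.
  - by rewrite lee_fin.
rewrite ge0_integralZr//.
- exact/measurable_EFinP.
- by move=> y _; rewrite lee_fin.
- by apply: integral_ge0 => y _; rewrite lee_fin.
Qed.

Lemma integral_sum_prodM (I : finType) (c : I -> I -> R)
    (a : I -> I -> T1 -> R) (b : I -> I -> T2 -> R) :
  (forall i j, measurable_fun [set: T1] (a i j)) ->
  (forall i j, measurable_fun [set: T2] (b i j)) ->
  (forall i j, (0 <= c i j)%R) ->
  (forall i j x, (0 <= a i j x)%R) -> (forall i j y, (0 <= b i j y)%R) ->
  \int[P1 \x P2]_z (\sum_i \sum_j c i j * (a i j z.1 * b i j z.2))%:E =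
  \sum_i \sum_j (c i j)%:E * (\int[P1]_x (a i j x)%:E * \int[P2]_y (b i j y)%:E).
Proof.
move=> ma mb c0 a0 b0.
have mab i j : measurable_fun [set: T1 * T2] (fun z => a i j z.1 * b i j z.2)%R.
  by apply: measurable_funM; exact: measurableT_comp.
under eq_integral do rewrite -sumEFin.
rewrite ge0_integral_sum//; last 2 first.
- move=> i; apply/measurable_EFinP; apply: measurable_sum => j.
  exact: measurable_funM.
- by move=> i z _; rewrite lee_fin; apply: sumr_ge0 => j _; rewrite !mulr_ge0.
apply: eq_bigr => i _.
under eq_integral do rewrite -sumEFin.
rewrite ge0_integral_sum//; last 2 first.
- by move=> j; apply/measurable_EFinP; exact: measurable_funM.
- by move=> j z _; rewrite lee_fin !mulr_ge0.
apply: eq_bigr => j _.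
under eq_integral do rewrite EFinM.
rewrite ge0_integralZl//; last 3 first.
- exact/measurable_EFinP.
- by move=> z _; rewrite lee_fin mulr_ge0.
- by rewrite lee_fin.
by rewrite integral_prodM.
Qed.

End product_integral.

(** * Coupling two laws through soft cells *)

Section soft_coupling.
Local Open Scope ereal_scope.
Context d1 d2 (T1 : measurableType d1) (T2 : measurableType d2) (R : realType).
Variables (P1 : probability T1 R) (P2 : probability T2 R) (I : finType).
Variables (u : I -> T1 -> R) (v : I -> T2 -> R) (p q : I -> R).
Variable gam : I -> I -> R.
Hypotheses (mu : forall i, measurable_fun [set: T1] (u i))
  (mv : forall i, measurable_fun [set: T2] (v i))
  (u0 : forall i x, (0 <= u i x)%R) (v0 : forall i x, (0 <= v i x)%R)
  (u1 : forall x, (\sum_i u i x = 1)%R) (v1 : forall x, (\sum_i v i x = 1)%R)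
  (pE : forall i, \int[P1]_x (u i x)%:E = (p i)%:E)
  (qE : forall i, \int[P2]_x (v i x)%:E = (q i)%:E)
  (gam0 : forall i j, (0 <= gam i j)%R)
  (gamp : forall i, (\sum_j gam i j = p i)%R)
  (gamq : forall j, (\sum_i gam i j = q j)%R).

(** Relative density on the pair of cells (i, j): mass [gam i j] in place of the product mass
    [p i * q j]. It is 0 when one of the cells is null, as x / 0 = 0. *)
Let w i j : R := (gam i j / (p i * q j))%R.

Let p0 i : (0 <= p i)%R.
Proof. by rewrite -gamp sumr_ge0. Qed.

Let q0 i : (0 <= q i)%R.
Proof. by rewrite -gamq sumr_ge0. Qed.

Let w0 i j : (0 <= w i j)%R.
Proof. by rewrite divr_ge0 ?mulr_ge0. Qed.

Let gam_le_p i j : (gam i j <= p i)%R.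
Proof. by rewrite -gamp (bigD1 j)//= lerDl sumr_ge0. Qed.

Let gam_le_q i j : (gam i j <= q j)%R.
Proof. by rewrite -gamq (bigD1 i)//= lerDl sumr_ge0. Qed.

(** A null [q j] loses nothing, since [gam i j <= q j] makes that entry 0 anyway; a null [p i] gives
    0 by the convention on division. *)
Let wq i : (\sum_j w i j * q j = (p i != 0)%:R)%R.
Proof.
transitivity (\sum_j gam i j / p i)%R.
  apply: eq_bigr => j _; rewrite /w invfM.
  have [qj0|qj] := eqVneq (q j) 0%R; last by rewrite mulrA mulfVK.
  have -> : gam i j = 0%R by apply/eqP; rewrite eq_le gam0 -qj0 gam_le_q.
  by rewrite !mul0r.
rewrite -mulr_suml gamp.
by have [->|pi0] := eqVneq (p i) 0%R; rewrite ?mul0r// divff.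
Qed.

Let wp j : (\sum_i w i j * p i = (q j != 0)%:R)%R.
Proof.
transitivity (\sum_i gam i j / q j)%R.
  apply: eq_bigr => i _; rewrite /w invfM [(_^-1 * _)%R]mulrC.
  have [pi0|pi] := eqVneq (p i) 0%R; last by rewrite mulrA mulfVK.
  have -> : gam i j = 0%R by apply/eqP; rewrite eq_le gam0 -pi0 gam_le_p.
  by rewrite !mul0r.
rewrite -mulr_suml gamq.
by have [->|pi0] := eqVneq (q j) 0%R; rewrite ?mul0r// divff.
Qed.

Let wpq i j : (w i j * (p i * q j) = gam i j)%R.
Proof.
have [pi0|pi] := eqVneq (p i) 0%R.
  have -> : gam i j = 0%R by apply/eqP; rewrite eq_le gam0 -pi0 gam_le_p.
  by rewrite pi0 mul0r mulr0.
have [qj0|qj] := eqVneq (q j) 0%R.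
  have -> : gam i j = 0%R by apply/eqP; rewrite eq_le gam0 -qj0 gam_le_q.
  by rewrite qj0 !mulr0.
by rewrite mulfVK// mulf_neq0.
Qed.

Let g (z : T1 * T2) : R := (\sum_i \sum_j w i j * (u i z.1 * v j z.2))%R.

Let mg : measurable_fun [set: T1 * T2] g.
Proof.
apply: measurable_sum => i; apply: measurable_sum => j.
apply: measurable_funM => //.
by apply: measurable_funM; exact: measurableT_comp.
Qed.

Let g0 z : (0 <= g z)%R.
Proof. by apply: sumr_ge0 => i _; apply: sumr_ge0 => j _; do 3?rewrite mulr_ge0//. Qed.

Let sum_p : (\sum_i p i = 1)%R.
Proof.
apply: EFin_inj; rewrite -sumEFin.
under eq_bigr do rewrite -pE.
rewrite -ge0_integral_sum//; last 2 first.
- by move=> i; exact/measurable_EFinP.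
- by move=> i x _; rewrite lee_fin.
under eq_integral do rewrite sumEFin u1.
by rewrite integral_cst//= probability_setT mul1e.
Qed.

Let g1 : \int[P1 \x P2]_z (g z)%:E = 1.
Proof.
rewrite (integral_sum_prodM P1 P2 (a := fun i _ => u i) (b := fun _ j => v j))//.
under eq_bigr do under eq_bigr do rewrite pE qE -!EFinM wpq.
by under eq_bigr do rewrite sumEFin gamp; rewrite sumEFin sum_p.
Qed.

(** Integrating out the second variable leaves the factor of [wq], which is 1 except where
    [p i = 0]. Such cells carry no mass, so their terms can be restored and the [u i] sum to 1. *)
Let margin1 (A : set T1) : measurable A ->
  \int[P1 \x P2]_(z in A `*` setT) (g z)%:E = P1 A.
Proof.
move=> mA; pose a i x := (\1_A x * u i x)%R.
have ma i : measurable_fun [set: T1] (a i) by exact: measurable_funM.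
have a0 i x : (0 <= a i x)%R by rewrite mulr_ge0// indicE.
have a_le i : \int[P1]_x (a i x)%:E <= (p i)%:E.
  rewrite -pE; apply: ge0_le_integral => //.
  - by move=> x _; rewrite lee_fin.
  - by apply/measurable_EFinP.
  - by apply/measurable_EFinP.
  - by move=> x _; rewrite lee_fin ler_piMl// indicE lern1 leq_b1.
have /choice[r rE] : forall i, exists r, \int[P1]_x (a i x)%:E = r%:E.
  move=> i; exists (fine (\int[P1]_x (a i x)%:E)); rewrite fineK//.
  rewrite ge0_fin_numE; last by apply: integral_ge0 => x _; rewrite lee_fin.
  by rewrite (le_lt_trans (a_le i))// ltry.
have rp i : (0 <= r i <= p i)%R.
  rewrite -!lee_fin -rE a_le andbT.
  by apply: integral_ge0 => x _; rewrite lee_fin.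
rewrite integral_mkcond.
transitivity (\int[P1 \x P2]_z (\sum_i \sum_j w i j * (a i z.1 * v j z.2))%:E).
  apply: eq_integral => -[x y] _; rewrite patchE /g /a indicE in_setX/= in_setT andbT.
  case: ifPn => _; last first.
    by rewrite big1// => i _; rewrite big1// => j _; rewrite !mul0r mulr0.
  by congr (_%:E); apply: eq_bigr => i _; apply: eq_bigr => j _; rewrite mul1r.
rewrite (integral_sum_prodM P1 P2 (a := fun i _ => a i) (b := fun _ j => v j))//.
under eq_bigr do under eq_bigr do rewrite rE qE -!EFinM.
under eq_bigr do rewrite sumEFin.
transitivity (\sum_i \int[P1]_x (a i x)%:E).
  apply: eq_bigr => i _; rewrite rE; congr (_%:E).
  under eq_bigr do rewrite mulrCA; rewrite -mulr_sumr wq.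
  have [pi0|] := eqVneq; rewrite ?mulr1// mulr0.
  by move: (rp i); rewrite pi0 => /andP[? ?]; apply/eqP; rewrite eq_le; apply/andP.
rewrite -ge0_integral_sum//; last 2 first.
- by move=> i; exact/measurable_EFinP.
- by move=> i x _; rewrite lee_fin.
under eq_integral do rewrite sumEFin -mulr_sumr u1 mulr1.
by rewrite integral_indic// setIT.
Qed.

Let margin2 (A : set T2) : measurable A ->
  \int[P1 \x P2]_(z in setT `*` A) (g z)%:E = P2 A.
Proof.
move=> mA; pose a i x := (\1_A x * v i x)%R.
have ma i : measurable_fun [set: T2] (a i) by exact: measurable_funM.
have a0 i x : (0 <= a i x)%R by rewrite mulr_ge0// indicE.
have a_le i : \int[P2]_x (a i x)%:E <= (q i)%:E.
  rewrite -qE; apply: ge0_le_integral => //.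
  - by move=> x _; rewrite lee_fin.
  - by apply/measurable_EFinP.
  - by apply/measurable_EFinP.
  - by move=> x _; rewrite lee_fin ler_piMl// indicE lern1 leq_b1.
have /choice[r rE] : forall i, exists r, \int[P2]_x (a i x)%:E = r%:E.
  move=> i; exists (fine (\int[P2]_x (a i x)%:E)); rewrite fineK//.
  rewrite ge0_fin_numE; last by apply: integral_ge0 => x _; rewrite lee_fin.
  by rewrite (le_lt_trans (a_le i))// ltry.
have rp i : (0 <= r i <= q i)%R.
  rewrite -!lee_fin -rE a_le andbT.
  by apply: integral_ge0 => x _; rewrite lee_fin.
rewrite integral_mkcond.
transitivity (\int[P1 \x P2]_z (\sum_i \sum_j w i j * (u i z.1 * a j z.2))%:E).
  apply: eq_integral => -[x y] _; rewrite patchE /g /a indicE in_setX/= in_setT/=.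
  case: ifPn => _; last first.
    by rewrite big1// => i _; rewrite big1// => j _; rewrite !mul0r !mulr0.
  by congr (_%:E); apply: eq_bigr => i _; apply: eq_bigr => j _; rewrite mul1r.
rewrite (integral_sum_prodM P1 P2 (a := fun i _ => u i) (b := fun _ j => a j))//.
under eq_bigr do under eq_bigr do rewrite rE pE -!EFinM.
rewrite exchange_big /=; under eq_bigr do rewrite sumEFin.
transitivity (\sum_i \int[P2]_x (a i x)%:E).
  apply: eq_bigr => i _; rewrite rE; congr (_%:E).
  under eq_bigr do rewrite mulrA; rewrite -mulr_suml wp.
  have [pi0|] := eqVneq; rewrite ?mul1r// mul0r.
  by move: (rp i); rewrite pi0 => /andP[? ?]; apply/eqP; rewrite eq_le; apply/andP.
rewrite -ge0_integral_sum//; last 2 first.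
- by move=> i; exact/measurable_EFinP.
- by move=> i x _; rewrite lee_fin.
under eq_integral do rewrite sumEFin -mulr_sumr v1 mulr1.
by rewrite integral_indic// setIT.
Qed.

(** Given a pair of cells, the two points are independent under the density [g]. Hence [a i]
    integrates against the first marginal only, [b j] against the second, and [D i j] against
    [gam]. *)
Lemma soft_coupling : exists G : probability (T1 * T2)%type R,
  [/\ forall A, measurable A -> G (A `*` setT) = P1 A,
      forall B, measurable B -> G (setT `*` B) = P2 B &
      forall (f : T1 * T2 -> R) (a : I -> T1 -> R) (b : I -> T2 -> R)
        (D : I -> I -> R), measurable_fun [set: T1 * T2] f ->
      (forall z, (0 <= f z)%R) ->
      (forall i, measurable_fun [set: T1] (a i)) ->
      (forall i, measurable_fun [set: T2] (b i)) ->
      (forall i x, (0 <= a i x)%R) -> (forall i y, (0 <= b i y)%R) ->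
      (forall i j, (0 <= D i j)%R) ->
      (forall i j x y, f (x, y) <= a i x + D i j + b j y)%R ->
      \int[G]_z (f z)%:E <= \sum_i \int[P1]_x (u i x * a i x)%:E
        + (\sum_i \sum_j gam i j * D i j)%:E
        + \sum_j \int[P2]_y (v j y * b j y)%:E].
Proof.
have [G [GE Gint]] := density_probability mg g0 g1.
exists G; split.
- by move=> A mA; rewrite GE ?margin1//; exact: measurableX.
- by move=> B mB; rewrite GE ?margin2//; exact: measurableX.
move=> f a b D mf f0 ma mb a0 b0 D0 fle.
rewrite Gint//; last exact/measurable_EFinP.
pose h1 (z : T1 * T2) := (\sum_i \sum_j w i j * ((u i z.1 * a i z.1) * v j z.2))%R.
pose h2 (z : T1 * T2) := (\sum_i \sum_j (w i j * D i j) * (u i z.1 * v j z.2))%R.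
pose h3 (z : T1 * T2) := (\sum_i \sum_j w i j * (u i z.1 * (v j z.2 * b j z.2)))%R.
have mh1 : measurable_fun [set: T1 * T2] h1.
  apply: measurable_sum => i; apply: measurable_sum => j.
  apply: measurable_funM => //; apply: measurable_funM; last exact: measurableT_comp.
  by apply: measurable_funM; exact: measurableT_comp.
have mh2 : measurable_fun [set: T1 * T2] h2.
  apply: measurable_sum => i; apply: measurable_sum => j.
  by apply: measurable_funM => //; apply: measurable_funM; exact: measurableT_comp.
have mh3 : measurable_fun [set: T1 * T2] h3.
  apply: measurable_sum => i; apply: measurable_sum => j.
  apply: measurable_funM => //; apply: measurable_funM; first exact: measurableT_comp.
  by apply: measurable_funM; exact: measurableT_comp.
have h10 z : (0 <= h1 z)%R.
  by apply: sumr_ge0 => i _; apply: sumr_ge0 => j _; do 3?rewrite mulr_ge0//.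
have h20 z : (0 <= h2 z)%R.
  by apply: sumr_ge0 => i _; apply: sumr_ge0 => j _; do 3?rewrite mulr_ge0//.
have h30 z : (0 <= h3 z)%R.
  by apply: sumr_ge0 => i _; apply: sumr_ge0 => j _; do 3?rewrite mulr_ge0//.
apply: (@le_trans _ _ (\int[P1 \x P2]_z ((h1 z)%:E + (h2 z)%:E + (h3 z)%:E))).
  apply: ge0_le_integral => //.
  - by move=> z _; rewrite mule_ge0// lee_fin.
  - by apply: emeasurable_funM => //; exact/measurable_EFinP.
  - by do 2?apply: emeasurable_funD; exact/measurable_EFinP.
  move=> [x y] _ /=; rewrite -EFinM -!EFinD lee_fin /g /h1 /h2 /h3 /=.
  rewrite mulr_sumr -!big_split/=; apply: ler_sum => i _.
  rewrite mulr_sumr -!big_split/=; apply: ler_sum => j _.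
  have -> : (w i j * (u i x * a i x * v j y) + w i j * D i j * (u i x * v j y) +
    w i j * (u i x * (v j y * b j y)) =
    (a i x + D i j + b j y) * (w i j * (u i x * v j y)))%R by ring.
  by rewrite ler_wpM2r// mulr_ge0// mulr_ge0.
rewrite ge0_integralD//; last 4 first.
- by move=> z _; rewrite -EFinD lee_fin addr_ge0.
- by rewrite /=; do !apply: emeasurable_funD; exact/measurable_EFinP.
- by move=> z _; rewrite lee_fin.
- exact/measurable_EFinP.
rewrite ge0_integralD//; last 4 first.
- by move=> z _; rewrite lee_fin.
- exact/measurable_EFinP.
- by move=> z _; rewrite lee_fin.
- exact/measurable_EFinP.
apply: leeD; first apply: leeD.
- rewrite (integral_sum_prodM P1 P2 (a := fun i _ x => (u i x * a i x)%R)
    (b := fun _ j => v j))//; last 2 first.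
  + by move=> i _; exact: measurable_funM.
  + by move=> i _ x; rewrite mulr_ge0.
  apply: lee_sum => i _.
  have A0 : 0 <= \int[P1]_x (u i x * a i x)%:E.
    by apply: integral_ge0 => x _; rewrite lee_fin mulr_ge0.
  under eq_bigr do rewrite qE muleCA muleC -EFinM.
  rewrite -ge0_sume_distrl; last by move=> j _; rewrite lee_fin mulr_ge0.
  rewrite sumEFin wq; case: eqP => _; first by rewrite mul0e.
  by rewrite mul1e.
- rewrite (integral_sum_prodM P1 P2 (c := fun i j => (w i j * D i j)%R)
    (a := fun i _ => u i) (b := fun _ j => v j))//.
    rewrite -sumEFin; apply: lee_sum => i _; rewrite -sumEFin; apply: lee_sum => j _.
    by rewrite pE qE -!EFinM lee_fin mulrAC wpq.
  by move=> i j; rewrite mulr_ge0.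
- rewrite (integral_sum_prodM P1 P2 (a := fun i _ => u i)
    (b := fun _ j y => (v j y * b j y)%R))//; last 2 first.
  + by move=> _ j; exact: measurable_funM.
  + by move=> _ j y; rewrite mulr_ge0.
  rewrite exchange_big /=; apply: lee_sum => j _.
  have A0 : 0 <= \int[P2]_x (v j x * b j x)%:E.
    by apply: integral_ge0 => x _; rewrite lee_fin mulr_ge0.
  under eq_bigr do rewrite pE muleA -EFinM.
  rewrite -ge0_sume_distrl; last by move=> i _; rewrite lee_fin mulr_ge0.
  rewrite sumEFin wp; case: eqP => _; first by rewrite mul0e.
  by rewrite mul1e.
Qed.

End soft_coupling.

Section dense_sequence.
Context (R : realType) (H : normedModType R).

Lemma separable_dense_seq : separable H -> exists d : nat -> H,
  forall (x : H) (e : R), 0 < e -> exists k, `|x - d k| < e.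
Proof.
move=> [D cD dD].
have [x0 Dx0] : D !=set0.
  by have [x [_ Dx]] := dD setT (ex_intro _ 0 I) openT; exists x.
move: cD => /pfcard_geP[D0|[d]]; first by move: Dx0; rewrite D0.
exists d => x e e0.
have xne : ball x e !=set0 by exists x; exact: ballxx.
have [y [xy Dy]] := dD _ xne (ball_open x e).
have [k _ dk] := @surj _ _ _ _ d _ Dy.
by exists k; rewrite dk; move: xy; rewrite -ball_normE.
Qed.

End dense_sequence.

(** * Algebra and continuity of the inner product *)

Section inner_product.
Context (R : realType) (H : normedModType R) (inner : {dot H for idfun}).
Hypothesis innerE : forall x : H, inner x x = `|x| ^+ 2.

Lemma innerC (x y : H) : inner x y = inner y x.
Proof. by rewrite hermC expr0 mul1r. Qed.

Lemma innerDl (x y z : H) : inner (x + y) z = inner x z + inner y z.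
Proof. exact: linearDl. Qed.

Lemma innerDr (x y z : H) : inner z (x + y) = inner z x + inner z y.
Proof. by rewrite innerC innerDl !(innerC z). Qed.

Lemma innerZl (a : R) (x y : H) : inner (a *: x) y = a * inner x y.
Proof. exact: linearZl_LR. Qed.

Lemma innerZr (a : R) (x y : H) : inner x (a *: y) = a * inner x y.
Proof. by rewrite innerC innerZl innerC. Qed.

Lemma inner0l (x : H) : inner 0 x = 0.
Proof. exact: linear0l. Qed.

Lemma inner0r (x : H) : inner x 0 = 0.
Proof. by rewrite innerC inner0l. Qed.

Lemma innerNl (x y : H) : inner (- x) y = - inner x y.
Proof. by rewrite -scaleN1r innerZl mulN1r. Qed.

Lemma innerBl (x y z : H) : inner (x - y) z = inner x z - inner y z.
Proof. by rewrite innerDl innerNl. Qed.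

Lemma innerBr (x y z : H) : inner z (x - y) = inner z x - inner z y.
Proof. by rewrite innerC innerBl !(innerC z). Qed.

Lemma inner_suml (I : Type) (r : seq I) (P : pred I) (F : I -> H) (z : H) :
  inner (\sum_(i <- r | P i) F i) z = \sum_(i <- r | P i) inner (F i) z.
Proof.
by apply: (big_morph (inner^~ z)) => [x y|]; rewrite (innerDl, inner0l).
Qed.

Lemma norm2D (x y : H) : `|x + y| ^+ 2 = `|x| ^+ 2 + 2 * inner x y + `|y| ^+ 2.
Proof.
rewrite -!innerE innerDl !innerDr (innerC y x); ring.
Qed.

Lemma norm2B (x y : H) : `|x - y| ^+ 2 = `|x| ^+ 2 - 2 * inner x y + `|y| ^+ 2.
Proof.
rewrite -!innerE innerBl !innerBr (innerC y x); ring.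
Qed.

(** Cauchy-Schwarz is read off from the triangle inequality of the norm: expanding |z + w|^2 <= (|z|
    + |w|)^2 leaves only the cross terms. *)
Lemma norm_inner_le (x y : H) : `|inner x y| <= `|x| * `|y|.
Proof.
have hD (z w : H) : inner z w <= `|z| * `|w|.
  have : `|z + w| ^+ 2 <= (`|z| + `|w|) ^+ 2.
    by rewrite ler_sqr ?nnegrE ?addr_ge0//; exact: ler_normD.
  by rewrite norm2D sqrrD -mulr_natl; nra.
rewrite ler_norml hD andbT lerNl -innerNl.
by rewrite (le_trans (hD _ _))// normrN.
Qed.

Lemma inner_continuous (v : H) : continuous (inner ^~ v).
Proof.
have -> : inner ^~ v = fun x => (`|x + v| ^+ 2 - `|x| ^+ 2 - `|v| ^+ 2) / 2.
  by apply/funext => x; rewrite norm2D; field.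
move=> x; apply: cvgMl; apply: cvgB; last exact: cvg_cst.
apply: cvgB.
  apply: (cvg_comp _ (fun t : R => t ^+ 2)); last exact: exprn_continuous.
  by apply: cvg_norm; apply: cvgD; [exact: cvg_id|exact: cvg_cst].
apply: (cvg_comp _ (fun t : R => t ^+ 2)); last exact: exprn_continuous.
by apply: cvg_norm; exact: cvg_id.
Qed.

End inner_product.

(** * Borel measurability on the Hilbert space *)

Section borel.
Context (R : realType) (H : normedModType R).

Lemma continuous_norm2B (f : H -> H) :
  continuous f -> continuous (fun x => `|x - f x| ^+ 2).
Proof.
move=> cf x; apply: (cvg_comp _ (fun t : R => t ^+ 2)); last exact: exprn_continuous.
by apply: cvg_norm; apply: cvgB; [exact: cvg_id|exact: cf].
Qed.

Lemma continuous_dist2 (c : H) : continuous (fun x : H => `|x - c| ^+ 2).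
Proof. by apply: continuous_norm2B => x; exact: cvg_cst. Qed.

Lemma continuous_norm2 : continuous (fun x : H => `|x| ^+ 2).
Proof.
by have := @continuous_dist2 0; under eq_fun do rewrite subr0.
Qed.

Lemma continuous_measurable_borel (f : H -> R) :
  continuous f -> measurable_fun [set: borel H] (f : borel H -> R).
Proof.
move=> /continuousP cf; apply: (measurability _ (RGenOpens.measurableE R)).
move=> _ [_ [a [b ->] <-]]; rewrite setTI.
by apply: sub_sigma_algebra; apply: cf; exact: interval_open.
Qed.

Lemma open_measurable_borel (U : set H) : open U -> measurable (U : set (borel H)).
Proof. by move=> oU; exact: sub_sigma_algebra. Qed.

(** Measurability of [X] and [Y] separately only controls functions of one of them. A dense sequence
    writes {|X - Y| < r} as a countable union of the sets {|X - s_k| + |Y - s_k| < r}, whose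
    summands involve one variable each. *)
Lemma measurable_dist d (T : measurableType d) (X Y : T -> borel H) :
  separable H -> measurable_fun [set: T] X -> measurable_fun [set: T] Y ->
  measurable_fun [set: T] (fun w => `|(X w : H) - (Y w : H)| : R).
Proof.
move=> /separable_dense_seq[s sd] mX mY.
have md (Z : T -> borel H) k : measurable_fun [set: T] Z ->
    measurable_fun [set: T] (fun w => `|(Z w : H) - s k| : R).
  move=> mZ; apply: (measurableT_comp (f := fun x : borel H => `|(x : H) - s k|)) => //.
  apply: (@continuous_measurable_borel (fun x => `|x - s k|)) => x.
  by apply: cvg_norm; apply: cvgB; [exact: cvg_id|exact: cvg_cst].
apply: (measurability _ (RGenInftyO.measurableE R)) => //.
move=> _ [_ [r ->] <-]; rewrite setTI.
have -> : (fun w => `|(X w : H) - (Y w : H)|) @^-1` `]-oo, r[ =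
    \bigcup_k ((fun w => `|(X w : H) - s k| + `|(Y w : H) - s k|) @^-1` `]-oo, r[).
  apply/seteqP; split => w /=; rewrite in_itv/=.
    (* The distance from Y to s_k is paid twice, once directly and once in |X - s_k| <= |X - Y| + |Y
       - s_k|; hence half of the gap. *)
    move=> XYr; have [|k yk] := sd (Y w) ((r - `|(X w : H) - (Y w : H)|) / 2).
      by rewrite divr_gt0// subr_gt0.
    exists k => //=; rewrite in_itv/=.
    have := ler_distD (Y w : H) (X w : H) (s k).
    by lra.
  move=> [k _ /=]; rewrite in_itv/=; apply: le_lt_trans.
  by rewrite (le_trans (ler_distD (s k) _ _))// (distrC (s k)).
apply: bigcup_measurable => k _; rewrite -[X in measurable X]setTI.
by apply: measurable_funD => //; exact: md.
Qed.

End borel.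

(** * Functions of quadratic growth *)

Section moments.
Context (R : realType) (H : normedModType R).
Implicit Types (f g : H -> R) (mu : P2 H).

(** The weight 1 + |x|^2 is integrable for every measure in [P2], and all approximation errors below
    are measured against it. *)
Definition growth2 f := exists C, forall x : H, `|f x| <= C * (1 + `|x| ^+ 2).

Lemma growth2_cst c : growth2 (fun=> c).
Proof. by exists `|c| => x; rewrite ler_peMr// lerDl sqr_ge0. Qed.

Lemma growth2D f g : growth2 f -> growth2 g -> growth2 (fun x => f x + g x).
Proof.
move=> [C fC] [D gD]; exists (C + D) => x.
by rewrite mulrDl (le_trans (ler_normD _ _))// lerD.
Qed.

Lemma growth2Z c f : growth2 f -> growth2 (fun x => c * f x).
Proof.
move=> [C fC]; exists (`|c| * C) => x.
by rewrite normrM -mulrA ler_wpM2l.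
Qed.

Lemma growth2_weight : growth2 (fun x : H => 1 + `|x| ^+ 2).
Proof. by exists 1 => x; rewrite mul1r ger0_norm// addr_ge0// sqr_ge0. Qed.

Lemma growth2_dist2 (c : H) : growth2 (fun x : H => `|x - c| ^+ 2).
Proof.
exists (2 + 2 * `|c| ^+ 2) => x; rewrite ger0_norm ?sqr_ge0//.
have xc : `|x - c| ^+ 2 <= (`|x| + `|c|) ^+ 2.
  by rewrite ler_sqr ?nnegrE ?addr_ge0//; exact: ler_normB.
have := sqr_ge0 (`|x| - `|c|); have := sqr_ge0 (`|c| * `|x|).
by move: xc (normr_ge0 x) (normr_ge0 c); nra.
Qed.

Lemma growth2_min_dist2 (a b : H) :
  growth2 (fun x => Num.min (`|x - a| ^+ 2) (`|x - b| ^+ 2)).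
Proof.
have [C CE] := growth2_dist2 a; exists C => x.
rewrite (le_trans _ (CE x))// !ger0_norm ?le_min ?sqr_ge0//.
by rewrite ge_min lexx.
Qed.

Lemma continuous_min_dist2 (a b : H) :
  continuous (fun x => Num.min (`|x - a| ^+ 2) (`|x - b| ^+ 2)).
Proof.
move=> x; exact: (@continuous_min R H (fun x => `|x - a| ^+ 2)
  (fun x => `|x - b| ^+ 2) x (@continuous_dist2 _ _ a x) (@continuous_dist2 _ _ b x)).
Qed.

Lemma continuous_weight : continuous (fun x : H => 1 + `|x| ^+ 2).
Proof. by move=> x; apply: cvgD; [exact: cvg_cst|exact: continuous_norm2]. Qed.

Lemma integrable_norm2 mu :
  mu.-integrable [set: borel H] (fun x : borel H => (`|x : H| ^+ 2)%:E).
Proof.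
apply/integrableP; split.
  apply/measurable_EFinP.
  exact: (@continuous_measurable_borel _ H _ (@continuous_norm2 R H)).
under eq_integral do rewrite /= ger0_norm ?sqr_ge0//.
exact: P2_moment.
Qed.

Lemma growth2_integrable mu f : continuous f -> growth2 f ->
  mu.-integrable [set: borel H] (EFin \o (f : borel H -> R)).
Proof.
move=> cf [C fC].
apply: (@le_integrable _ _ _ _ _ _ _
  (fun x : borel H => (C * (1 + `|x : H| ^+ 2))%:E)) => //.
- by apply/measurable_EFinP; exact: continuous_measurable_borel.
- by move=> x _; rewrite lee_fin (le_trans (fC x))// ler_norm.
- under eq_fun do rewrite EFinM.
  apply: integrableZl => //.
  under eq_fun do rewrite EFinD.
  apply: integrableD => //; last exact: integrable_norm2.
  exact: finite_measure_integrable_cst.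
Qed.

End moments.

(** * Trigonometric estimates and piecewise linear interpolation on the line *)

Section real_functions.
Context (R : realType).
Implicit Types (h : R -> R) (s t : R).

Lemma cos_lipschitz s t : `|cos s - cos t| <= `|s - t|.
Proof.
wlog ts : s t / t <= s.
  by move=> W; have /orP[/W//|/W] := le_total t s; rewrite distrC (distrC s).
have [c _ ->] := @MVT_segment R cos (fun x => - sin x) t s ts
  (fun x _ => is_derive_cos x) (continuous_subspaceT (@continuous_cos R)).
by rewrite normrM normrN ler_piMl// sin_max.
Qed.

(** For t >= 0 the mean value theorem gives sin t = t cos c, and |cos c - cos 0| <= c <= t. *)
Lemma sin_sub_id_le t : `|sin t - t| <= t ^+ 2.
Proof.
wlog t0 : t / 0 <= t.
  move=> W; have [/W//|t0] := leP 0 t.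
  have := W (- t); rewrite sinN sqrrN -opprD normrN; apply.
  by rewrite oppr_ge0 ltW.
have [c] := @MVT_segment R sin cos 0 t t0
  (fun x _ => is_derive_sin x) (continuous_subspaceT (@continuous_sin R)).
rewrite in_itv/= sin0 !subr0 => /andP[c0 ct] ->.
have -> : cos c * t - t = (cos c - cos 0) * t by rewrite cos0; ring.
rewrite normrM (ger0_norm t0) expr2 ler_wpM2r//.
by rewrite (le_trans (cos_lipschitz _ _))// subr0 ger0_norm.
Qed.

Definition hinge t s : R := Num.max (s - t) 0.

Definition knot (t0 del : R) (n : nat) : R := t0 + n%:R * del.

Lemma knotS t0 del n : knot t0 del n.+1 = knot t0 del n + del.
Proof. by rewrite /knot -natr1; ring. Qed.

(** A difference of consecutive hinges is a ramp rising from 0 to [del] between two knots. Each new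
    term thus leaves the function unchanged to the left of its knots, and the result is constant
    outside the range of knots. *)
Fixpoint interpolant h t0 del n : R -> R := if n is m.+1 then
    fun s => interpolant h t0 del m s +
      (h (knot t0 del n) - h (knot t0 del m)) / del *
      (hinge (knot t0 del m) s - hinge (knot t0 del n) s)
  else fun=> h t0.

Lemma interpolant_spec h t0 del n :
  (forall s t, `|h s - h t| <= `|s - t|) -> 0 < del ->
  let kn := knot t0 del n in let g := interpolant h t0 del n in
  [/\ forall s, kn <= s -> g s = h kn,
      forall s, s <= t0 -> g s = h t0 &
      forall s, t0 <= s -> s <= kn -> `|h s - g s| <= 2 * del].
Proof.
move=> lip del0.
have knot0 m : t0 <= knot t0 del m by rewrite lerDl mulr_ge0// ltW.
elim: n => [|n [IHr IHl IHm]].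
  have k0 : knot t0 del 0 = t0 by rewrite /knot mul0r addr0.
  split=> //= [s _|s s0]; first by rewrite k0.
  rewrite k0 => s1; have -> : s = t0 by lra.
  by rewrite subrr normr0 mulr_ge0// ltW.
have hingeE1 s t : t <= s -> hinge t s = s - t.
  by move=> ts; rewrite /hinge; apply: max_l; lra.
have hingeE0 s t : s <= t -> hinge t s = 0.
  by move=> ts; rewrite /hinge; apply: max_r; lra.
have := knot0 n.+1; have := knot0 n => /=.
rewrite knotS; move: (knot t0 del n) IHr IHl IHm => k IHr IHl IHm k0 k1.
split=> /= [s|s s0|s s0].
- move=> ks; rewrite IHr; last by lra.
  rewrite !hingeE1; [|lra|lra].
  rewrite (_ : s - k - (s - (k + del)) = del); last by ring.
  by rewrite divfK ?gt_eqF// addrC subrK.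
- by rewrite IHl// !hingeE0; [rewrite subrr mulr0 addr0|lra|lra].
- move=> sk; have [sn|ns] := leP s k.
    by rewrite !hingeE0; [rewrite subrr mulr0 addr0; exact: IHm|lra|lra].
  rewrite (IHr _ (ltW ns)) (hingeE1 _ _ (ltW ns)) hingeE0// subr0.
  (* Beyond the knot [k], the variation of [h] and the height of the partial ramp are both at most
     [del]. *)
  rewrite opprD addrA (le_trans (ler_normB _ _))//.
  have -> : 2 * del = del + del by ring.
  apply: lerD.
    by rewrite (le_trans (lip _ _))// ger0_norm; lra.
  rewrite mulrAC -mulrA normrM.
  have d1 : `|(s - k) / del| <= 1.
    by rewrite ger0_norm ?divr_ge0 ?ler_pdivrMr; lra.
  have d2 : `|h (k + del) - h k| <= del.
    by rewrite (le_trans (lip _ _))// addrC addKr ger0_norm// ltW.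
  rewrite -[leRHS]mulr1; exact: ler_pM.
Qed.

(** Interpolation is uniformly good on a bounded interval, and outside it boundedness of [h] is
    enough because the weight is large. The class [S] will be the set of [g] whose composition with
    a linear form is a test function. *)
Lemma hinge_approx h (eps : R) (S : set (R -> R)) :
  (forall s t, `|h s - h t| <= `|s - t|) -> (forall s, `|h s| <= 1) -> 0 < eps ->
  (forall c, S (fun=> c)) -> (forall t, S (hinge t)) ->
  (forall c f g, S f -> S g -> S (fun s => f s + c * g s)) ->
  exists2 g, S g & forall s, `|h s - g s| <= eps * (1 + s ^+ 2).
Proof.
move=> lip h1 eps0 Scst Shinge Slin.
(* [M] ensures eps * M ^ 2 >= 2, and 2 bounds the error beyond the interval; [del] turns the
   interpolation error 2 * del into eps. *)
pose M : R := 1 + 2 / eps; pose del := eps / 2.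
have del0 : 0 < del by rewrite divr_gt0.
have M1 : 1 <= M by rewrite lerDl divr_ge0// ltW.
have M2 : 2 <= eps * M ^+ 2.
  apply: (@le_trans _ _ (eps * M)).
    by rewrite mulrDr mulr1 mulrCA divff ?gt_eqF// mulr1 lerDr ltW.
  by rewrite ler_pM2l// expr2 ler_peMl//; lra.
have [N MN] : exists N : nat, 2 * M / del <= N%:R.
  exists (Num.truncn (2 * M / del)).+1; apply/ltW.
  exact: truncnS_gt.
have [gr gl gm] := interpolant_spec (- M) N lip del0.
exists (interpolant h (- M) del N).
  elim: N {MN gr gl gm} => [|n IH]; first exact: Scst.
  rewrite /=.
  set a := _ / del.
  apply: (@eq_ind _ _ S (Slin (- a) _ _ (Slin a _ _ IH
    (Shinge (knot (- M) del n))) (Shinge (knot (- M) del n.+1)))).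
  by apply/funext => s; rewrite /knot; ring.
have MN2 : M <= knot (- M) del N.
  rewrite /knot; move: MN; rewrite ler_pdivrMr//; lra.
have far s t : M <= `|s| -> `|h s - h t| <= eps * (1 + s ^+ 2).
  move=> Ms; rewrite (le_trans (ler_normB _ _))//.
  apply: (@le_trans _ _ 2); first by have := h1 s; have := h1 t; lra.
  rewrite (le_trans M2)// ler_pM2l//.
  apply: (@le_trans _ _ (`|s| ^+ 2)); first by rewrite ler_pXn2r// nnegrE; lra.
  by rewrite real_normK ?num_real// lerDr.
move=> s; have [sM|Ms] := leP s (- M).
  by rewrite gl// far//; rewrite ler0_norm; lra.
have [sN|Ns] := leP s (knot (- M) del N).
  rewrite (le_trans (gm _ (ltW Ms) sN))//.
  by rewrite /del mulrC divfK// ler_peMr ?lerDl ?sqr_ge0// ltW.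
by rewrite (gr _ (ltW Ns)) far//; rewrite ger0_norm; lra.
Qed.

End real_functions.

(** * Functions whose integrals converge along the filter *)

Section test_functions.
Context (R : realType) (H : normedModType R) (inner : {dot H for idfun}).
Hypothesis innerE : forall x : H, inner x x = `|x| ^+ 2.
Context (F : set_system (P2 H)) {FF : Filter F} (mu : P2 H).
Implicit Types (f g : H -> R) (nu : P2 H).

(** Continuity and growth are bundled with the convergence so that integrals may be split, and
    linear combinations then require no side condition. *)
Definition test_function f := [/\ continuous f, growth2 f &
  (fun nu : P2 H => \int[nu]_(x in [set: borel H]) f x) @ F -->
    \int[mu]_(x in [set: borel H]) f x].

Lemma test_cst c : test_function (fun=> c).
Proof.
split; [by move=> x; exact: cvg_cst|exact: growth2_cst|].
have Ec nu : \int[nu]_(x in [set: borel H]) c = c.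
  by rewrite Rintegral_cst//= probability_setT/= mulr1.
by rewrite Ec; under eq_fun do rewrite Ec; exact: cvg_cst.
Qed.

Lemma test_lin c f g : test_function f -> test_function g ->
  test_function (fun x => f x + c * g x).
Proof.
move=> [cf gf lf] [cg gg lg]; split.
- by move=> x; apply: cvgD; [exact: cf|apply: cvgMr; exact: cg].
- by apply: growth2D => //; exact: growth2Z.
have E nu : \int[nu]_(x in [set: borel H]) (f x + c * g x) =
    \int[nu]_(x in [set: borel H]) f x + c * \int[nu]_(x in [set: borel H]) g x.
  rewrite RintegralD//; last 2 first.
  - exact: growth2_integrable.
  - apply: (@growth2_integrable R H nu (fun x => c * g x)); last exact: growth2Z.
    by move=> x; apply: cvgMr; exact: cg.
  by rewrite RintegralZl//; exact: growth2_integrable.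
rewrite E; under eq_fun do rewrite E.
by apply: cvgD => //; exact: cvgMr.
Qed.

Lemma testZ c f : test_function f -> test_function (fun x => c * f x).
Proof.
move=> tf; have := test_lin c (test_cst 0) tf.
by under eq_fun do rewrite add0r.
Qed.

Lemma testD f g : test_function f -> test_function g ->
  test_function (fun x => f x + g x).
Proof.
move=> tf tg; have := test_lin 1 tf tg.
by under eq_fun do rewrite mul1r.
Qed.

Lemma testB f g : test_function f -> test_function g ->
  test_function (fun x => f x - g x).
Proof.
move=> tf tg; have := test_lin (-1) tf tg.
by under eq_fun do rewrite mulN1r.
Qed.

Lemma test_sum (I : Type) (r : seq I) (P : pred I) (f : I -> H -> R) :
  (forall i, P i -> test_function (f i)) ->
  test_function (fun x => \sum_(i <- r | P i) f i x).
Proof.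
move=> tf; elim: r => [|i r IH].
  by under eq_fun do rewrite big_nil; exact: test_cst.
under eq_fun do rewrite big_cons.
by case: (boolP (P i)) => Pi //; apply: testD => //; exact: tf.
Qed.

Lemma le_Rintegral_weight nu f g del : continuous f -> continuous g ->
  growth2 f -> growth2 g -> (forall x, `|f x - g x| <= del * (1 + `|x| ^+ 2)) ->
  `|\int[nu]_(x in [set: borel H]) f x - \int[nu]_(x in [set: borel H]) g x| <=
    del * \int[nu]_(x in [set: borel H]) (1 + `|x : H| ^+ 2).
Proof.
move=> cf cg gf gg fg.
have cfg : continuous (fun x => f x - g x).
  by move=> x; apply: cvgB; [exact: cf|exact: cg].
have gfg : growth2 (fun x => f x - g x).
  exists del; exact: fg.
have ifg := growth2_integrable nu cfg gfg.
have iw := growth2_integrable nu (@continuous_weight R H) (@growth2_weight R H).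
rewrite -RintegralB//; [|exact: growth2_integrable|exact: growth2_integrable].
rewrite (le_trans (le_normr_Rintegral _ _))// -RintegralZl//.
apply: le_Rintegral => //.
- exact: integrable_norm.
- apply: (@growth2_integrable R H nu (fun x => del * (1 + `|x : H| ^+ 2))).
    by move=> x; apply: cvgMr; exact: continuous_weight.
  by apply: growth2Z; exact: growth2_weight.
Qed.

Hypothesis e22_cvg : forall a b : H, e22 nu a b @[nu --> F] --> e22 mu a b.

Lemma test_min (a b : H) :
  test_function (fun x => Num.min (`|x - a| ^+ 2) (`|x - b| ^+ 2)).
Proof.
have min0 (x : H) : 0 <= Num.min (`|x - a| ^+ 2) (`|x - b| ^+ 2).
  by rewrite le_min !sqr_ge0.
split; [exact: continuous_min_dist2|exact: growth2_min_dist2|].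
have e2 nu : \int[nu]_(x in [set: borel H]) 
    Num.min (`|(x : H) - a| ^+ 2) (`|(x : H) - b| ^+ 2) = e22 nu a b ^+ 2.
  by rewrite sqr_sqrtr// Rintegral_ge0.
rewrite e2; under eq_fun do rewrite e2.
by apply: (cvg_comp _ (fun t : R => t ^+ 2)); [exact: e22_cvg|exact: exprn_continuous].
Qed.

Lemma test_norm2 (a : H) : test_function (fun x => `|x - a| ^+ 2).
Proof. by have := test_min a a; under eq_fun do rewrite minxx. Qed.

Lemma test_weight : test_function (fun x => 1 + `|x| ^+ 2).
Proof.
have := testD (test_cst 1) (test_norm2 0).
by under eq_fun do rewrite subr0.
Qed.

(** The weight is itself a test function, so its integrals are eventually below M + 1 along [F], and
    a small weighted error stays small after integration against the moving measure. *)
Lemma test_approx f : continuous f ->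
  (forall del, 0 < del ->
    exists2 g, test_function g & forall x, `|f x - g x| <= del * (1 + `|x| ^+ 2)) ->
  test_function f.
Proof.
move=> cf fapp; have gf : growth2 f.
  have [g [_ [C gC] _] fg] := fapp 1 ltr01; exists (1 + C) => x.
  by rewrite mulrDl -[f x](subrK (g x)) (le_trans (ler_normD _ _))// lerD.
split=> //; apply/cvgrPdist_le => e e0.
set M := \int[mu]_(x in [set: borel H]) (1 + `|x : H| ^+ 2).
have M0 : 0 <= M by apply: Rintegral_ge0 => x _; rewrite addr_ge0// sqr_ge0.
(* Budget: e / 4 for the approximation error under [mu], e / 4 for the one under [nu], and e / 2 for
   the convergence of the integrals of [g]. *)
pose del := e / (4 * (M + 1)).
have del0 : 0 < del by rewrite divr_gt0// mulr_gt0//; lra.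
have delE : del * (4 * (M + 1)) = e by rewrite divfK//; apply: lt0r_neq0; lra.
have [g [cg gg lg] fg] := fapp _ del0.
have [_ _ lw] := test_weight.
have e2 : 0 < e / 2 by rewrite divr_gt0.
move/cvgrPdist_le : lg => /(_ _ e2) lg.
move/cvgrPdist_le : lw => /(_ _ ltr01); rewrite -/M => lw.
near=> nu.
have Hw : `|M - \int[nu]_(x in [set: borel H]) (1 + `|x : H| ^+ 2)| <= 1 by near: nu.
have Hg : `|\int[mu]_(x in [set: borel H]) g x -
    \int[nu]_(x in [set: borel H]) g x| <= e / 2.
  by near: nu.
have Hmu := le_Rintegral_weight mu cf cg gf gg fg.
have Hnu := le_Rintegral_weight nu cf cg gf gg fg.
move: Hw Hg Hmu Hnu; rewrite -/M !ler_norml.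
move: (\int[nu]_(x in [set: borel H]) (1 + `|x : H| ^+ 2))
  (\int[mu]_(x in [set: borel H]) g x)
  (\int[nu]_(x in [set: borel H]) g x)
  (\int[mu]_(x in [set: borel H]) f x) (\int[nu]_(x in [set: borel H]) f x)
  => Mn mg ng mf nf.
move=> /andP[W1 W2] /andP[G1 G2] /andP[A1 A2] /andP[B1 B2].
have : del * Mn <= del * (M + 1) by rewrite ler_pM2l//; lra.
by move=> D1; apply/andP; split; lra.
Unshelve. all: by end_near. Qed.

(** Let A and B be the squared distances to two points on the line spanned by [v]. Then A - min (A,
    B) = max (A - B, 0), and A - B is affine in <x,v> because |x|^2 cancels. *)
Lemma test_hinge (v : H) (t : R) : test_function (fun x => hinge t (inner x v)).
Proof.
have [v0|v0] := eqVneq v 0.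
  by rewrite v0; under eq_fun do rewrite (inner0r inner); exact: test_cst.
have nv0 : `|v| ^+ 2 != 0 by rewrite expf_neq0// normr_eq0.
(* Points at parameters s and s + 1/2 give A - B slope 1 in <x,v> and the zero (s + 1/4) |v|^2,
   which this [s] places at [t]. *)
pose s := t / `|v| ^+ 2 - 1 / 4.
have := testB (test_norm2 (s *: v)) (test_min (s *: v) ((s + 1 / 2) *: v)).
congr test_function; apply/funext => x; rewrite /hinge.
have sE : s * `|v| ^+ 2 = t - `|v| ^+ 2 / 4.
  by rewrite /s mulrBl divfK//; ring.
have -> : inner x v - t = `|x - s *: v| ^+ 2 - `|x - (s + 1 / 2) *: v| ^+ 2.
  rewrite !(norm2B innerE) !(innerZr inner) !normrZ !exprMn !real_normK ?num_real//.
  by rewrite -[t](subrK (`|v| ^+ 2 / 4)) -sE; field.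
move: (`|x - s *: v| ^+ 2) (`|x - (s + 1 / 2) *: v| ^+ 2) => A B.
have [AB|BA] := leP A B.
  by rewrite max_r; [rewrite subrr|lra].
by rewrite max_l//; lra.
Qed.

Lemma test_cos (w : H) (th : R) : test_function (fun x => cos (inner x w + th)).
Proof.
apply: test_approx => [x|del del0].
  apply: (cvg_comp _ (fun t : R => cos t)); last exact: continuous_cos.
  by apply: cvgD; [exact: inner_continuous|exact: cvg_cst].
(* The error is controlled by 1 + <x,w>^2, which Cauchy-Schwarz bounds by (1 + |w|^2) (1 +
   |x|^2). *)
pose del' := del / (1 + `|w| ^+ 2).
have w0 : 0 < 1 + `|w| ^+ 2 by rewrite ltr_pwDl// sqr_ge0.
have [||||||g gS gE] := @hinge_approx R (fun s => cos (s + th)) del'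
    [set g | test_function (fun x => g (inner x w))].
- by move=> s t; rewrite (le_trans (cos_lipschitz _ _))// opprD addrACA subrr addr0.
- by move=> s; exact: cos_max.
- by rewrite divr_gt0.
- by move=> c /=; exact: test_cst.
- by move=> t /=; exact: test_hinge.
- by move=> c f g /= tf tg; exact: test_lin.
exists (fun x => g (inner x w)) => // x.
rewrite (le_trans (gE _))// /del' -mulrA ler_pM2l// mulrC ler_pdivrMr//.
have : inner x w ^+ 2 <= (`|x| * `|w|) ^+ 2.
  rewrite -[leLHS]real_normK ?num_real//.
  by rewrite ler_sqr ?nnegrE ?mulr_ge0//; exact: norm_inner_le.
by rewrite exprMn; have := sqr_ge0 `|x|; have := sqr_ge0 `|w|; nra.
Qed.

End test_functions.

(** * Trigonometric partitions of unity as random walks *)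

Section trig_partition.
Context (R : realType) (H : normedModType R) (inner : {dot H for idfun}).
Hypothesis innerE : forall x : H, inner x x = `|x| ^+ 2.

(** Mean of the sum of independent steps [j.2] or [- j.2], taken with the probabilities
    [trig_factor]; [sin_defect] is the variance of that sum. *)
Definition sin_field (J : seq (H * H)) (x : H) : H :=
  \sum_(j <- J) sin (inner x j.1) *: j.2.

Definition sin_defect (J : seq (H * H)) (x : H) : R :=
  \sum_(j <- J) `|j.2| ^+ 2 * (1 - sin (inner x j.1) ^+ 2).

Definition trig_factor (b : bool) (w x : H) : R :=
  (1 + (-1) ^+ b * sin (inner x w)) / 2.

(** One more pair doubles the index set: weights are multiplied by the probability of a sign and
    centres move by v or - v. The cost identity is kept for all z, because the induction applies it
    at z + v and z - v. The clause on [S] is an induction principle, used later for continuity and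
    for [trig_test]. *)
Lemma trig_partition (J : seq (H * H)) :
  exists (I : finType) (phi : I -> H -> R) (c : I -> H),
  [/\ forall i x, 0 <= phi i x, forall x, \sum_i phi i x = 1,
      forall S : set (H -> R), S (fun=> 1) ->
        (forall f b w, S f -> S (fun x => f x * trig_factor b w x)) ->
        forall i, S (phi i) &
      forall x z, \sum_i phi i x * `|z - c i| ^+ 2 =
        `|z - sin_field J x| ^+ 2 + sin_defect J x].
Proof.
elim: J => [|[w v] J [I [phi [c [phi0 phi1 phiS phiE]]]]].
  exists 'I_1, (fun _ _ => 1), (fun=> 0); split => //.
  - by move=> x; rewrite big_ord1.
  - move=> x z; rewrite /sin_field /sin_defect !big_nil subr0 addr0.
    by rewrite big_ord1 mul1r.
have fac0 b x : 0 <= trig_factor b w x.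
  have := sin_max (inner x w); rewrite ler_norml => /andP[s1 s2].
  by rewrite divr_ge0//; case: b; rewrite ?expr0 ?expr1; lra.
exists (I * bool)%type, (fun (i : I * bool) x => phi i.1 x * trig_factor i.2 w x),
  (fun i : I * bool => c i.1 + (-1) ^+ i.2 *: v); split => [i x|x|S S1 Sf i|x z].
- by rewrite mulr_ge0.
- rewrite -(pair_bigA _ (fun i b => phi i x * trig_factor b w x))/=.
  under eq_bigr do rewrite big_bool/= /trig_factor expr0 expr1 -mulrDr.
  by rewrite -mulr_suml phi1; field.
- exact: (Sf (phi i.1) i.2 w (phiS S S1 Sf i.1)).
rewrite -(pair_bigA _ (fun i b => phi i x * trig_factor b w x *
  `|z - (c i + (-1) ^+ b *: v)| ^+ 2))/=.
under eq_bigr => i _.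
  rewrite big_bool/= expr0 expr1 scaleN1r scale1r.
  rewrite (_ : z - (c i - v) = (z + v) - c i); last first.
    by rewrite opprB addrA.
  rewrite (_ : z - (c i + v) = (z - v) - c i); last first.
    by rewrite opprD addrA addrAC.
  rewrite [X in X + _]mulrAC [X in _ + X]mulrAC.
  over.
rewrite big_split/= -!mulr_suml !phiE /trig_factor expr0 expr1.
rewrite /sin_field /sin_defect !big_cons/=.
set T := \sum_(j <- J) sin _ *: _; set V := \sum_(j <- J) _ * _.
set u := sin (inner x w).
have -> : z + v - T = (z - T) + v by rewrite addrAC.
have -> : z - v - T = (z - T) - v by rewrite addrAC.
have -> : z - (u *: v + T) = (z - T) - u *: v by rewrite opprD addrA addrAC.
move: (z - T) => y.
rewrite !(norm2B innerE) (norm2D innerE) !(innerZr inner) normrZ exprMn.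
rewrite real_normK ?num_real//.
by field.
Qed.

End trig_partition.

(** * Products of sine factors are test functions *)

Section trig_test.
Context (R : realType) (H : normedModType R) (inner : {dot H for idfun}).
Hypothesis innerE : forall x : H, inner x x = `|x| ^+ 2.
Context (F : set_system (P2 H)) {FF : Filter F} (mu : P2 H).
Hypothesis e22_cvg :
  forall a b : H, e22 nu a b @[nu --> F] --> e22 mu a b.

(** Test functions are not visibly stable under products; requiring the property after
    multiplication by every cosine makes it stable under multiplication by sines. *)
Definition trig_test (f : H -> R) := forall w th,
  test_function F mu (fun x => f x * cos (inner x w + th)).

Lemma trig_test1 : trig_test (fun=> 1).
Proof. by move=> w th; under eq_fun do rewrite mul1r; exact: test_cos. Qed.

(** This is 2 sin A cos B = sin (A + B) + sin (A - B), each sine being a cosine with phase shifted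
    by pi / 2. *)
Lemma trig_test_factor f b w :
  trig_test f -> trig_test (fun x => f x * trig_factor inner b w x).
Proof.
move=> tf w' th.
have /(_ FF FF FF) := testZ 2^-1 (test_lin ((-1) ^+ b / 2) (tf w' th)
  (testD (tf (w + w') (th - pi / 2)) (tf (w - w') (- th - pi / 2)))).
congr (test_function _ _ _); apply/funext => x; rewrite /trig_factor.
rewrite (innerDr inner) (innerBr inner) !addrA !cosBpihalf.
rewrite -[_ + _ + th]addrA sinD.
rewrite -[_ - _ - th]addrA -opprD sinB.
by field.
Qed.

Lemma trig_test_test f : trig_test f -> test_function F mu f.
Proof.
move=> /(_ 0 0); congr (test_function _ _ _); apply/funext => x.
by rewrite (inner0r inner) addr0 cos0 mulr1.
Qed.

(** The unbounded factor <x,c> equals sin (d <x,c>) / d up to an error d <x,c>^2, a small multiple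
    of the weight, and the sine version is covered by [trig_test]. *)
Lemma trig_test_inner f (c : H) : (forall x, `|f x| <= 1) -> trig_test f ->
  test_function F mu (fun x => f x * inner x c).
Proof.
move=> f1 tf; apply: (@test_approx R H F FF mu e22_cvg) => [|del del0].
  have [cf _ _] := trig_test_test tf.
  by move=> x; apply: cvgM; [exact: cf|exact: inner_continuous].
pose d := del / (1 + `|c| ^+ 2).
have c0 : 0 < 1 + `|c| ^+ 2 by rewrite ltr_pwDl// sqr_ge0.
have d0 : 0 < d by rewrite divr_gt0.
exists (fun x => d^-1 * (f x * cos (inner x (d *: c) + - (pi / 2)))).
  exact: testZ.
move=> x; rewrite cosBpihalf (innerZr inner).
have -> : f x * inner x c - d^-1 * (f x * sin (d * inner x c)) =
    f x * (d^-1 * - (sin (d * inner x c) - d * inner x c)).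
  by field; rewrite gt_eqF.
rewrite !normrM normrN (ger0_norm (_ : 0 <= d^-1)); last by rewrite invr_ge0 ltW.
apply: (@le_trans _ _ (1 * (d^-1 * (d * inner x c) ^+ 2))).
  apply: ler_pM => //; first by rewrite mulr_ge0// invr_ge0 ltW.
  by apply: ler_wpM2l; [rewrite invr_ge0 ltW|exact: sin_sub_id_le].
have -> : 1 * (d^-1 * (d * inner x c) ^+ 2) = d * inner x c ^+ 2.
  by field; rewrite gt_eqF.
rewrite /d -mulrA ler_pM2l//.
rewrite mulrC ler_pdivrMr//.
have : inner x c ^+ 2 <= (`|x| * `|c|) ^+ 2.
  rewrite -[leLHS]real_normK ?num_real//.
  by rewrite ler_sqr ?nnegrE ?mulr_ge0//; exact: norm_inner_le.
by rewrite exprMn; have := sqr_ge0 `|x|; have := sqr_ge0 `|c|; nra.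
Qed.

End trig_test.

(** * Orthonormal systems and bounded approximations of the identity *)

Section gram_schmidt.
Context (R : realType) (H : normedModType R) (inner : {dot H for idfun}).
Hypothesis innerE : forall x : H, inner x x = `|x| ^+ 2.
Implicit Types (s : seq H) (x y e : H).

Definition proj s x : H := \sum_(e <- s) inner x e *: e.

(* Zero vectors are allowed, so that the Gram-Schmidt recursion needs no test
   for linear dependence. *)
Inductive orthonormal0 : seq H -> Prop :=
| orthonormal0_nil : orthonormal0 [::]
| orthonormal0_rcons s e : orthonormal0 s -> {in s, forall e', inner e' e = 0} ->
    (e = 0 \/ `|e| = 1) -> orthonormal0 (rcons s e).

Lemma proj_rcons s e x : proj (rcons s e) x = proj s x + inner x e *: e.
Proof. by rewrite /proj -cats1 big_cat big_seq1. Qed.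

Lemma unit0_inner e x : e = 0 \/ `|e| = 1 -> inner x e * `|e| ^+ 2 = inner x e.
Proof.
by move=> [->|->]; [rewrite (inner0r inner) mul0r|rewrite expr1n mulr1].
Qed.

Lemma orthonormal0_norm2 s (a : H -> R) : orthonormal0 s ->
  `|\sum_(e <- s) a e *: e| ^+ 2 = \sum_(e <- s) a e ^+ 2 * `|e| ^+ 2.
Proof.
elim=> [|{}s e _ IH se _]; first by rewrite !big_nil normr0 expr0n.
rewrite -cats1 !big_cat !big_seq1/= (norm2D innerE) IH (innerZr inner).
have -> : inner (\sum_(e <- s) a e *: e) e = 0.
  rewrite (inner_suml inner) big_seq big1// => e' es.
  by rewrite (innerZl inner) se// mulr0.
by rewrite !mulr0 addr0 normrZ exprMn real_normK ?num_real.
Qed.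

Lemma orthonormal0_unit s e : orthonormal0 s -> e \in s -> e = 0 \/ `|e| = 1.
Proof.
elim=> // {}s e' _ IH _ e'1; rewrite mem_rcons in_cons => /orP[/eqP->//|].
exact: IH.
Qed.

Lemma proj_norm2 s x : orthonormal0 s ->
  `|proj s x| ^+ 2 = \sum_(e <- s) inner x e ^+ 2.
Proof.
move=> os; rewrite orthonormal0_norm2// big_seq [RHS]big_seq.
apply: eq_bigr => e es; rewrite expr2 -mulrA unit0_inner//.
exact: orthonormal0_unit es.
Qed.

Lemma sub_proj_norm2 s x : orthonormal0 s ->
  `|x - proj s x| ^+ 2 = `|x| ^+ 2 - \sum_(e <- s) inner x e ^+ 2.
Proof.
move=> os; rewrite (norm2B innerE) proj_norm2//.
have -> : inner x (proj s x) = \sum_(e <- s) inner x e ^+ 2.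
  rewrite (innerC inner) (inner_suml inner); apply: eq_bigr => e _.
  by rewrite (innerZl inner) (innerC inner e) expr2.
by ring.
Qed.

Lemma bessel s x : orthonormal0 s -> \sum_(e <- s) inner x e ^+ 2 <= `|x| ^+ 2.
Proof. by move=> os; rewrite -subr_ge0 -sub_proj_norm2// sqr_ge0. Qed.

Lemma inner_proj s x e : orthonormal0 s -> e \in s -> inner (proj s x) e = inner x e.
Proof.
elim=> // {}s e' os IH se e'1; rewrite mem_rcons in_cons proj_rcons.
rewrite (innerDl inner) (innerZl inner) => /orP[/eqP ->|es].
  rewrite innerE unit0_inner// (inner_suml inner) big_seq big1 ?add0r//.
  by move=> e2 e2s; rewrite (innerZl inner) se// mulr0.
by rewrite IH// (innerC inner e') (se e)// mulr0 addr0.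
Qed.

Lemma projB s x y : proj s (x - y) = proj s x - proj s y.
Proof.
rewrite -sumrB; apply: eq_bigr => e _.
by rewrite (innerBl inner) scalerBl.
Qed.

(** As [proj s] fixes [y], the residue of x is that of x - y, and a residue is never longer than the
    vector itself. *)
Lemma sub_proj_le s x y : orthonormal0 s -> proj s y = y ->
  `|x - proj s x| <= `|x - y|.
Proof.
move=> os sy; have -> : x - proj s x = (x - y) - proj s (x - y).
  by rewrite projB sy opprB addrA subrK.
rewrite -ler_sqr ?nnegrE// sub_proj_norm2// lerBlDr lerDl.
by apply: sumr_ge0 => e _; exact: sqr_ge0.
Qed.

Section sequence.
Variable d : nat -> H.

Fixpoint gram_schmidt n : seq H := if n is m.+1 then
    let s := gram_schmidt m in let r := d m - proj s (d m) in
    rcons s (`|r|^-1 *: r)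
  else [::].

Lemma orthonormal0_gram_schmidt n : orthonormal0 (gram_schmidt n).
Proof.
elim: n => [|n IH] /=; first exact: orthonormal0_nil.
set r := _ - _; apply: orthonormal0_rcons => //.
  move=> e es; rewrite (innerZr inner) /r (innerBr inner).
  by rewrite (innerC inner e (proj _ _)) inner_proj// (innerC inner e) subrr mulr0.
have [->|r0] := eqVneq r 0; first by left; rewrite scaler0.
by right; rewrite normrZ normfV normr_id mulVf// normr_eq0.
Qed.

(** The new vector absorbs exactly the residue of [d n]. An earlier [d k] is already equal to its
    projection, hence orthogonal to that residue and unaffected. *)
Lemma proj_gram_schmidt n k : (k < n)%N -> proj (gram_schmidt n) (d k) = d k.
Proof.
elim: n => // n IH; rewrite ltnS leq_eqVlt => /orP[/eqP ->|kn] /=;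
  have os := orthonormal0_gram_schmidt n; have := orthonormal0_gram_schmidt n.+1;
  rewrite /= proj_rcons; set s := gram_schmidt n in os *; set r := d n - _ => os1.
  have sr e : e \in s -> inner e r = 0.
    move=> es; rewrite /r (innerBr inner) (innerC inner e (proj _ _)).
    by rewrite inner_proj// (innerC inner e) subrr.
  have rr : inner (d n) r = `|r| ^+ 2.
    rewrite -innerE {2}/r (innerBl inner) (inner_suml inner) big_seq big1 ?subr0//.
    by move=> e es; rewrite (innerZl inner) sr// mulr0.
  have [r0|r0] := eqVneq r 0.
    by rewrite r0 !scaler0 addr0; apply/eqP; rewrite eq_sym -subr_eq0 -/r r0.
  rewrite (innerZr inner) rr scalerA (_ : _ * _ = 1); last first.
    by field; rewrite normr_eq0.
  by rewrite scale1r /r addrC subrK.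
have dk := IH kn; have -> : inner (d k) (`|r|^-1 *: r) = 0.
  rewrite (innerZr inner) -dk (inner_suml inner) big_seq big1 ?mulr0// => e es.
  rewrite (innerZl inner) /r (innerBr inner) (innerC inner e (proj _ _)).
  by rewrite inner_proj// (innerC inner e) subrr mulr0.
by rewrite scale0r addr0.
Qed.

Hypothesis d_dense : forall x (e : R), 0 < e -> exists k, `|x - d k| < e.

(** The projection with each coordinate t replaced by L sin (t / L), where L = n + 1 is never 0. One
    index drives both the number of directions and the scale L. *)
Definition sin_proj n x : H :=
  \sum_(e <- gram_schmidt n) (n.+1%:R * sin (n.+1%:R^-1 * inner x e)) *: e.

Lemma sin_proj_dist n x :
  `|x - sin_proj n x| ^+ 2 <= 2 * `|x - proj (gram_schmidt n) x| ^+ 2 +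
    2 * \sum_(e <- gram_schmidt n)
      (inner x e - n.+1%:R * sin (n.+1%:R^-1 * inner x e)) ^+ 2.
Proof.
have os := orthonormal0_gram_schmidt n.
set s := gram_schmidt n in os *.
set z := \sum_(e <- s) _.
have zle : `|proj s x - sin_proj n x| ^+ 2 <= z.
  rewrite -sumrB; under eq_bigr do rewrite -scalerBl.
  rewrite orthonormal0_norm2// !big_seq /z big_seq; apply: ler_sum => e es.
  rewrite ler_piMr ?sqr_ge0//.
  by case: (orthonormal0_unit os es) => ->; rewrite ?normr0 ?expr0n ?expr1n.
have := sqr_ge0 (`|x - proj s x| - `|proj s x - sin_proj n x|).
have : `|x - sin_proj n x| ^+ 2 <= (`|x - proj s x| + `|proj s x - sin_proj n x|) ^+ 2.
  by rewrite ler_sqr ?nnegrE ?addr_ge0//; exact: ler_distD.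
move: zle; rewrite -/z.
move: `|_ - _| `|_ - _| `|_ - _| z => a b c z; nra.
Qed.

(** The first bound serves pointwise convergence and the second serves domination. They rest on |sin
    u - u| <= u^2 and on |sin u| <= |u| at u = t / L. *)
Lemma sin_scaled_le n (t : R) :
  (t - n.+1%:R * sin (n.+1%:R^-1 * t)) ^+ 2 <= n.+1%:R^-1 ^+ 2 * t ^+ 4 /\
  (t - n.+1%:R * sin (n.+1%:R^-1 * t)) ^+ 2 <= 4 * t ^+ 2.
Proof.
set L : R := n.+1%:R; have L0 : 0 < L by rewrite /L ltr0n.
have -> : t - L * sin (L^-1 * t) = - (L * (sin (L^-1 * t) - L^-1 * t)).
  by field; rewrite gt_eqF.
rewrite sqrrN exprMn; split.
  apply: (@le_trans _ _ (L ^+ 2 * ((L^-1 * t) ^+ 2) ^+ 2)).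
    rewrite ler_wpM2l ?sqr_ge0// -[leLHS]real_normK ?num_real//.
    by rewrite ler_sqr ?nnegrE ?sqr_ge0//; exact: sin_sub_id_le.
  have -> : L ^+ 2 * ((L^-1 * t) ^+ 2) ^+ 2 = L^-1 ^+ 2 * t ^+ 4.
    by field; rewrite gt_eqF.
  by [].
have -> : 4 * t ^+ 2 = L ^+ 2 * (2 * (L^-1 * t)) ^+ 2.
  by field; rewrite gt_eqF.
rewrite ler_wpM2l ?sqr_ge0// -[leLHS]real_normK ?num_real//.
rewrite -[leRHS]real_normK ?num_real// ler_sqr ?nnegrE//.
rewrite (le_trans (ler_normB _ _))// (normrM 2) (ger0_norm (_ : 0 <= 2))//.
rewrite mulr_natl mulr2n lerD2r.
by have := cos_lipschitz (L^-1 * t - pi / 2) (- (pi / 2));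
  rewrite cosBpihalf cosN cos_pihalf subr0 opprK subrK.
Qed.

(** The constant is 2 + 2 * 4: the residue is at most |x|, and Bessel bounds the sum of the 4
    <x,e>^2. *)
Lemma sin_proj_dominated n x : `|x - sin_proj n x| ^+ 2 <= 10 * `|x| ^+ 2.
Proof.
have os := orthonormal0_gram_schmidt n.
apply: (le_trans (sin_proj_dist n x)).
have -> : 10 * `|x| ^+ 2 = 2 * `|x| ^+ 2 + 2 * (4 * `|x| ^+ 2) by ring.
apply: lerD; rewrite ler_pM2l//.
  by rewrite sub_proj_norm2// lerBlDr lerDl; apply: sumr_ge0 => e _; exact: sqr_ge0.
apply: (le_trans (ler_sum _ (fun e _ => (sin_scaled_le n (inner x e)).2))).
by rewrite -mulr_sumr ler_pM2l//; exact: bessel.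
Qed.

(** In the sum of the <x,e>^4, one factor <x,e>^2 is bounded by |x|^2 and the other is summed by
    Bessel. The bound |x|^4 does not depend on the number of directions, so the factor L^-2 sends
    this term to 0. *)
Lemma sin_proj_cvg x : `|x - sin_proj n x| ^+ 2 @[n --> \oo] --> (0 : R).
Proof.
have cn : (n.+1%:R^-1 : R) @[n --> \oo] --> (0 : R) by exact: cvg_harmonic.
apply: (@squeeze_cvgr _ _ _ _ (fun=> 0)
  (fun n => 2 * `|x - proj (gram_schmidt n) x| ^+ 2 +
    2 * (n.+1%:R^-1 ^+ 2 * `|x| ^+ 4))); last first.
- have -> : (0 : R) = 2 * (0 * 0) + 2 * ((0 * 0) * `|x| ^+ 4) by ring.
  apply: cvgD; apply: cvgMr; last first.
    by apply: cvgMl; under eq_fun do rewrite expr2; exact: cvgM.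
  have cp : `|x - proj (gram_schmidt n) x| @[n --> \oo] --> (0 : R).
    apply/cvgrPdist_lt => e e0; have [k dk] := d_dense x e0.
    near=> n; rewrite sub0r normrN normr_id.
    apply: le_lt_trans dk; apply: sub_proj_le.
      exact: orthonormal0_gram_schmidt.
    by apply: proj_gram_schmidt; near: n; exact: nbhs_infty_gt.
  by under eq_fun do rewrite expr2; exact: cvgM.
- exact: cvg_cst.
near=> n; rewrite sqr_ge0/=; apply: (le_trans (sin_proj_dist n x)).
have os := orthonormal0_gram_schmidt n.
rewrite lerD2l ler_pM2l//.
apply: (le_trans (ler_sum _ (fun e _ => (sin_scaled_le n (inner x e)).1))).
rewrite -mulr_sumr ler_wpM2l ?sqr_ge0//.
apply: (@le_trans _ _ (\sum_(e <- gram_schmidt n) `|x| ^+ 2 * inner x e ^+ 2)).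
  rewrite big_seq [leRHS]big_seq; apply: ler_sum => e es.
  rewrite (_ : inner x e ^+ 4 = inner x e ^+ 2 * inner x e ^+ 2); last by ring.
  rewrite ler_wpM2r ?sqr_ge0// (le_trans _ (bessel x os))//.
  rewrite (perm_big _ (perm_to_rem es)) big_cons lerDl.
  by apply: sumr_ge0 => *; exact: sqr_ge0.
rewrite -mulr_sumr (_ : `|x| ^+ 4 = `|x| ^+ 2 * `|x| ^+ 2); last by ring.
by rewrite ler_wpM2l ?sqr_ge0//; exact: bessel.
Unshelve. all: by end_near. Qed.

End sequence.
End gram_schmidt.

(** * Partitions of small cost *)

Section partition_of_unity.
Context (R : realType) (H : normedModType R) (inner : {dot H for idfun}).
Hypothesis innerE : forall x : H, inner x x = `|x| ^+ 2.

Lemma continuous_sin_proj d n : continuous (sin_proj inner d n).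
Proof.
move=> x; apply: cvg_big => [|e _]; first exact: add_continuous.
apply: cvgZr_tmp; apply: cvgMr.
apply: (cvg_comp _ (fun t : R => sin t)); last exact: continuous_sin.
by apply: cvgMr; exact: inner_continuous.
Qed.

Lemma sin_proj_integral_cvg (mu : P2 H) d (eps : R) :
  (forall (x : H) (e : R), 0 < e -> exists k, `|x - d k| < e) -> 0 < eps ->
  exists n, \int[mu]_(x in [set: borel H])
    (`|(x : H) - sin_proj inner d n x| ^+ 2) <= eps.
Proof.
move=> dd eps0.
pose f n (x : H) := `|x - sin_proj inner d n x| ^+ 2.
have cf n : continuous (f n).
  exact/continuous_norm2B/continuous_sin_proj.
have f_le n x : `|f n x| <= 10 * `|x| ^+ 2.
  by rewrite ger0_norm ?sqr_ge0//; exact: sin_proj_dominated.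
have [|||||_ _] := @dominated_convergence _ (borel H) R mu setT measurableT
  (fun n (x : borel H) => (f n x)%:E) (cst 0%E)
  (fun x : borel H => (10 * `|x : H| ^+ 2)%:E).
- by move=> n; apply/measurable_EFinP; exact: continuous_measurable_borel.
- exact: measurable_cst.
- apply: aeW => x _; apply: cvg_EFin; first by near=> n.
  exact: sin_proj_cvg.
- have := integrableZl (mu := mu) measurableT 10 (integrable_norm2 mu).
  by apply: eq_integrable.
- by apply: aeW => x n _; rewrite lee_fin.
rewrite integral0 => /fine_cvgP[fin] /cvgrPdist_le /(_ _ eps0) fcvg.
near \oo => n; exists n.
have : `|0 - \int[mu]_(x in [set: borel H]) f n x| <= eps by near: n.
by rewrite sub0r normrN => /(le_trans (ler_norm _)).
Unshelve. all: by end_near. Qed.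

Lemma continuous_mul_trig_factor (f : H -> R) b w :
  continuous f -> continuous (fun x => f x * trig_factor inner b w x).
Proof.
move=> cf x; apply: cvgM; first exact: cf.
apply: cvgMl; apply: cvgD; first exact: cvg_cst.
apply: cvgMr; apply: (cvg_comp _ (fun t : R => sin t)); last exact: continuous_sin.
exact: inner_continuous.
Qed.

Variable sepH : separable H.

Lemma continuous_cost (I : finType) (phi : I -> H -> R) (c : I -> H) :
  (forall i, continuous (phi i)) ->
  continuous (fun x => \sum_i phi i x * `|x - c i| ^+ 2).
Proof.
move=> cphi x; apply: cvg_big => [|i _]; first exact: add_continuous.
apply: cvgM.
  exact: cphi.
exact: continuous_dist2.
Qed.

Lemma partition_of_unity (mu : P2 H) (eps : R) : 0 < eps ->
  exists (I : finType) (phi : I -> H -> R) (c : I -> H),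
  [/\ forall i x, 0 <= phi i x, forall x, \sum_i phi i x = 1,
      forall S : set (H -> R), S (fun=> 1) ->
        (forall f b w, S f -> S (fun x => f x * trig_factor inner b w x)) ->
        forall i, S (phi i) &
      \int[mu]_(x in [set: borel H]) (\sum_i phi i x * `|(x : H) - c i| ^+ 2) <= eps].
Proof.
move=> eps0; have [d dd] := separable_dense_seq sepH.
have eps2 : 0 < eps / 2 by rewrite divr_gt0.
have [n nE] := sin_proj_integral_cvg mu dd eps2.
set s := gram_schmidt inner d n.
have os : orthonormal0 inner s := orthonormal0_gram_schmidt innerE d n.
pose L : R := n.+1%:R; have L0 : 0 < L by rewrite /L ltr0n.
(* K steps of length at most L / K in each of [size s] directions have total variance at most [A] /
   K. *)
pose A : R := (size s)%:R * L ^+ 2.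
have [K Kpos KE] : exists2 K : nat, (0 < K)%N & A / (eps / 2) <= K%:R.
  by exists (Num.truncn (A / (eps / 2))).+1 => //; apply/ltW; exact: truncnS_gt.
have K0 : 0 < K%:R :> R by rewrite ltr0n.
(* Cutting a step L e into K independent equal pieces keeps the mean L sin (<x,e> / L) e and divides
   the variance by K. *)
pose J := [seq (L^-1 *: e, (L / K%:R) *: e) | e <- s, k <- iota 0 K].
have [I [phi [c [phi0 phi1 phiS phiE]]]] := trig_partition innerE J.
exists I, phi, c; split => //.
have TE x : sin_field inner J x = sin_proj inner d n x.
  rewrite /sin_field /J big_allpairs_dep; apply: eq_bigr => e _ /=.
  rewrite (innerZr inner) scalerA big_const_seq count_predT size_iota iter_addr_0.
  by rewrite -scaler_nat scalerA; congr (_ *: _); field; rewrite gt_eqF.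
have VE x : sin_defect inner J x <= eps / 2.
  apply: (@le_trans _ _ (A / K%:R)); last first.
    by rewrite ler_pdivrMr// -ler_pdivrMl// mulrC.
  rewrite /sin_defect /J big_allpairs_dep.
  apply: (@le_trans _ _ (\sum_(e <- s) L ^+ 2 / K%:R)); last first.
    by rewrite big_const_seq count_predT iter_addr_0 /A -mulrA mulr_natl.
  rewrite big_seq [leRHS]big_seq; apply: ler_sum => e es /=.
  rewrite big_const_seq count_predT size_iota iter_addr_0 -[leLHS]mulr_natl.
  rewrite normrZ (ger0_norm (_ : 0 <= L / K%:R)); last by rewrite divr_ge0// ltW.
  have e1 : `|e| ^+ 2 <= 1.
    by case: (orthonormal0_unit os es) => ->; rewrite ?normr0 ?expr0n ?expr1n.
  set u := sin _; have u1 : 1 - u ^+ 2 <= 1 by rewrite lerBlDr lerDl sqr_ge0.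
  have u0 : 0 <= 1 - u ^+ 2 by rewrite /u -cos2sin2 sqr_ge0.
  have -> : K%:R * ((L / K%:R * `|e|) ^+ 2 * (1 - u ^+ 2)) =
    (L ^+ 2 / K%:R) * (`|e| ^+ 2 * (1 - u ^+ 2)) by field; rewrite gt_eqF.
  apply: ler_piMr; first by rewrite divr_ge0 ?sqr_ge0 ?ltW.
  by apply: mulr_ile1 => //; exact: sqr_ge0.
have cphi i : continuous (phi i).
  apply: (phiS [set f | continuous f]) => [x|f b w cf] /=; first exact: cvg_cst.
  exact: continuous_mul_trig_factor.
have cD := continuous_cost (c := c) cphi.
have DE x : \sum_i phi i x * `|x - c i| ^+ 2 <=
    `|x - sin_proj inner d n x| ^+ 2 + eps / 2.
  by rewrite phiE TE lerD2l.
have cS : continuous (fun x => `|x - sin_proj inner d n x| ^+ 2).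
  exact/continuous_norm2B/continuous_sin_proj.
have cT : continuous (fun x => `|x - sin_proj inner d n x| ^+ 2 + eps / 2).
  by move=> x; apply: cvgD; [exact: cS|exact: cvg_cst].
have gT : growth2 (fun x => `|x - sin_proj inner d n x| ^+ 2).
  exists 10 => x; rewrite ger0_norm ?sqr_ge0//.
  rewrite (le_trans (sin_proj_dominated innerE d n x))//.
  by rewrite ler_pM2l// lerDr.
have gT2 := growth2D gT (growth2_cst H (eps / 2)).
have gD : growth2 (fun x => \sum_i phi i x * `|x - c i| ^+ 2).
  have [C CE] := gT2; exists C => x; rewrite ger0_norm.
    by rewrite (le_trans (DE x))// (le_trans _ (CE x))// ler_norm.
  by apply: sumr_ge0 => i _; rewrite mulr_ge0// sqr_ge0.
apply: (@le_trans _ _ (\int[mu]_(x in [set: borel H])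
    (`|(x : H) - sin_proj inner d n x| ^+ 2 + eps / 2))).
  apply: le_Rintegral => //; exact: growth2_integrable.
rewrite RintegralD//; last 2 first.
- exact: (@growth2_integrable R H mu (fun x => `|x - sin_proj inner d n x| ^+ 2)).
- exact: finite_measure_integrable_cst.
rewrite Rintegral_cst//= probability_setT/= mulr1.
by rewrite [leRHS]splitr lerD2r.
Qed.

End partition_of_unity.

(** * Image laws and the L^2 triangle inequality *)

Section laws.
Local Open Scope ereal_scope.
Context d d' (T : measurableType d) (T' : measurableType d') (R : realType).

Lemma integral_law (P : probability T R) (Q : probability T' R) (X : T -> T')
    (f : T' -> \bar R) : measurable_fun [set: T] X ->
  (forall A, measurable A -> P (X @^-1` A) = Q A) ->
  measurable_fun [set: T'] f -> (forall y, 0 <= f y) ->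
  \int[P]_x f (X x) = \int[Q]_y f y.
Proof.
move=> mX PQ mf f0.
rewrite -(@ge0_integral_pushforward _ _ _ _ _ _ mX P setT f)//.
by apply: eq_measure_integral => A mA _; exact: PQ.
Qed.

Lemma image_probability (P : probability T R) (X : T -> T') :
  measurable_fun [set: T] X ->
  exists Q : probability T' R, forall A, measurable A -> Q A = P (X @^-1` A).
Proof.
move=> mX; pose Y : {mfun T >-> T'} := HB.pack X (isMeasurableFun.Build _ _ _ _ X mX).
by exists (distribution P Y).
Qed.

(** Minkowski in quadratic form: (a + b)^2 <= (1 + s/r) a^2 + (1 + r/s) b^2, the gap being (s a - r
    b)^2 / (r s). With these weights the bounds r^2 and s^2 add up to exactly (r + s)^2. *)
Lemma l2_triangle (P : {measure set T -> \bar R}) (a b c : T -> R) (r s : R) :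
  measurable_fun [set: T] a -> measurable_fun [set: T] b ->
  measurable_fun [set: T] c ->
  (forall x, 0 <= c x <= a x + b x)%R -> (0 < r)%R -> (0 < s)%R ->
  \int[P]_x (a x ^+ 2)%:E <= (r ^+ 2)%:E ->
  \int[P]_x (b x ^+ 2)%:E <= (s ^+ 2)%:E ->
  \int[P]_x (c x ^+ 2)%:E <= ((r + s) ^+ 2)%:E.
Proof.
move=> ma mb mc cab r0 s0 ar bs.
have mX2 (h : T -> R) : measurable_fun [set: T] h ->
    measurable_fun [set: T] (fun x => (h x ^+ 2)%:E).
  by move=> mh; apply/measurable_EFinP; exact: measurable_funX.
have sr0 : (0 <= 1 + s / r)%R by rewrite addr_ge0// divr_ge0// ltW.
have rs0 : (0 <= 1 + r / s)%R by rewrite addr_ge0// divr_ge0// ltW.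
apply: (@le_trans _ _ (\int[P]_x 
    ((1 + s / r)%:E * (a x ^+ 2)%:E + (1 + r / s)%:E * (b x ^+ 2)%:E))).
  apply: ge0_le_integral => //.
  - by move=> x _; rewrite lee_fin sqr_ge0.
  - exact: mX2.
  - by apply: emeasurable_funD; apply: emeasurable_funM => //; exact: mX2.
  move=> x _; rewrite -!EFinM -EFinD lee_fin.
  have /andP[c0 cle] := cab x.
  apply: (@le_trans _ _ ((a x + b x) ^+ 2)%R).
    by rewrite ler_sqr ?nnegrE// (le_trans c0).
  rewrite -subr_ge0 (_ : (_ - _ = (s * a x - r * b x) ^+ 2 / (r * s))%R).
    by rewrite divr_ge0 ?sqr_ge0// mulr_ge0// ltW.
  by field; rewrite !gt_eqF.
rewrite ge0_integralD//; last 4 first.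
- by move=> x _; rewrite mule_ge0// lee_fin ?sqr_ge0.
- by apply: emeasurable_funM => //; exact: mX2.
- by move=> x _; rewrite mule_ge0// lee_fin ?sqr_ge0.
- by apply: emeasurable_funM => //; exact: mX2.
rewrite !ge0_integralZl//; last 4 first.
- exact: mX2.
- by move=> x _; rewrite lee_fin sqr_ge0.
- exact: mX2.
- by move=> x _; rewrite lee_fin sqr_ge0.
apply: (@le_trans _ _ ((1 + s / r)%:E * (r ^+ 2)%:E + (1 + r / s)%:E * (s ^+ 2)%:E)).
  by apply: leeD; apply: lee_wpmul2l => //; rewrite lee_fin.
rewrite -!EFinM -EFinD lee_fin le_eqVlt; apply/orP; left; apply/eqP.
by field; rewrite !gt_eqF.
Qed.

End laws.

Lemma preimage_fstE (T1 T2 : Type) (A : set T1) : fst @^-1` A = A `*` [set: T2].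
Proof. by apply/seteqP; split=> -[x y] //= []. Qed.

Lemma preimage_sndE (T1 T2 : Type) (A : set T2) : snd @^-1` A = [set: T1] `*` A.
Proof. by apply/seteqP; split=> -[x y] //= []. Qed.

(** * Gluing laws along a partition of small cost *)

Section gluing.
Context (R : realType) (H : normedModType R) (sepH : separable H).

Variables (I : finType) (phi : I -> H -> R) (c : I -> H).
Hypotheses (phic : forall i, continuous (phi i)) (phi0 : forall i x, 0 <= phi i x)
  (phi1 : forall x, \sum_i phi i x = 1).

Lemma phi_le1 i x : phi i x <= 1.
Proof. by rewrite -(phi1 x) (bigD1 i)//= lerDl sumr_ge0. Qed.

Lemma growth2_phi i : growth2 (phi i).
Proof.
exists 1 => x; rewrite mul1r ger0_norm// (le_trans (phi_le1 i x))//.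
by rewrite lerDl sqr_ge0.
Qed.

Let growth2_summand i : growth2 (fun x => phi i x * `|x - c i| ^+ 2).
Proof.
have [C CE] := growth2_dist2 (c i); exists C => x.
by rewrite normrM (le_trans _ (CE x))// ger0_norm// ler_piMl// phi_le1.
Qed.

Let continuous_summand i : continuous (fun x => phi i x * `|x - c i| ^+ 2).
Proof. by move=> x; apply: cvgM; [exact: phic|exact: continuous_dist2]. Qed.

Lemma growth2_cost : growth2 (fun x => \sum_i phi i x * `|x - c i| ^+ 2).
Proof.
have gs : forall r : seq I, growth2 (fun x => \sum_(i <- r) phi i x * `|x - c i| ^+ 2).
  elim=> [|i r IH]; first by under eq_fun do rewrite big_nil; exact: growth2_cst.
  by under eq_fun do rewrite big_cons; exact: growth2D.
exact: gs.
Qed.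

Definition cost (nu : P2 H) : R :=
  \int[nu]_(x in [set: borel H]) (\sum_i phi i x * `|(x : H) - c i| ^+ 2).

Let cost_sum nu : (cost nu)%:E =
  (\sum_i \int[nu]_(x in [set: borel H]) (phi i x * `|(x : H) - c i| ^+ 2)%:E)%E.
Proof.
rewrite /cost /Rintegral fineK; last first.
  apply: integrable_fin_num => //.
  exact: (growth2_integrable nu (continuous_cost (c := c) phic) growth2_cost).
under eq_integral do rewrite -sumEFin.
rewrite ge0_integral_sum// => [i|i x _].
  by apply/measurable_EFinP; exact: continuous_measurable_borel.
by rewrite lee_fin mulr_ge0// sqr_ge0.
Qed.

(** Working through [X] and [Y] allows whole couplings to be glued: with pairs as base points, one
    coordinate of each is matched while the full laws [Pa] and [Pb] are preserved. *)
Lemma gluing d1 d2 (T1 : measurableType d1) (T2 : measurableType d2)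
    (Pa : probability T1 R) (Pb : probability T2 R)
    (X : T1 -> borel H) (Y : T2 -> borel H) (mu nu : P2 H) (gam : I -> I -> R) :
  measurable_fun [set: T1] X -> measurable_fun [set: T2] Y ->
  (forall A, measurable A -> Pa (X @^-1` A) = mu A) ->
  (forall A, measurable A -> Pb (Y @^-1` A) = nu A) ->
  (forall i j, 0 <= gam i j) ->
  (forall i, \sum_j gam i j = \int[mu]_(x in [set: borel H]) phi i x) ->
  (forall j, \sum_i gam i j = \int[nu]_(x in [set: borel H]) phi j x) ->
  exists G : probability (T1 * T2)%type R,
  [/\ forall A, measurable A -> G (A `*` setT) = Pa A,
      forall B, measurable B -> G (setT `*` B) = Pb B &
      (\int[G]_z (`|(X z.1 : H) - (Y z.2 : H)| ^+ 2)%:E <=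
       (3 * (cost mu + \sum_i \sum_j gam i j * `|c i - c j| ^+ 2 + cost nu))%:E)%E].
Proof.
move=> mX mY PX PY gam0 gammu gamnu.
have mphi i : measurable_fun [set: borel H] (phi i : borel H -> R).
  exact: continuous_measurable_borel.
have intphi (m : P2 H) i : (\int[m]_x (phi i x)%:E)%E =
    (\int[m]_(x in [set: borel H]) phi i x)%:E.
  rewrite /Rintegral fineK//; apply: integrable_fin_num => //.
  exact: (growth2_integrable m (@phic i) (growth2_phi i)).
have mc i : measurable_fun [set: borel H] (fun x : borel H => 3 * `|(x : H) - c i| ^+ 2).
  apply: (@continuous_measurable_borel R H (fun x => 3 * `|x - c i| ^+ 2)) => x.
  by apply: cvgMr; exact: continuous_dist2.
have mprod i : measurable_fun [set: borel H]
    (fun x : borel H => (phi i x * (3 * `|(x : H) - c i| ^+ 2))%:E).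
  by apply/measurable_EFinP; exact: measurable_funM.
have [|||||||||||G [G1 G2 GE]] := @soft_coupling _ _ _ _ R Pa Pb I
  (fun i => phi i \o X) (fun i => phi i \o Y)
  (fun i => \int[mu]_(x in [set: borel H]) phi i x)
  (fun i => \int[nu]_(x in [set: borel H]) phi i x) gam => //.
- by move=> i; exact: measurableT_comp.
- by move=> i; exact: measurableT_comp.
- by move=> i x /=.
- by move=> i x /=.
- by move=> x /=.
- by move=> x /=.
- move=> i; rewrite (integral_law (f := fun x : borel H => (phi i x)%:E) mX PX) ?intphi//.
    by apply/measurable_EFinP.
  by move=> x; rewrite lee_fin.
- move=> i; rewrite (integral_law (f := fun x : borel H => (phi i x)%:E) mY PY) ?intphi//.
    by apply/measurable_EFinP.
  by move=> x; rewrite lee_fin.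
exists G; split => //.
(* The factor 3 is that of (q + r + s)^2 <= 3 (q^2 + r^2 + s^2), along the path from X through c_i
   and c_j to Y. *)
have := GE (fun z => `|(X z.1 : H) - (Y z.2 : H)| ^+ 2)
  (fun i x => 3 * `|(X x : H) - c i| ^+ 2) (fun i x => 3 * `|(Y x : H) - c i| ^+ 2)
  (fun i j => 3 * `|c i - c j| ^+ 2).
have E3 (m : P2 H) : (\sum_i \int[m]_(x in [set: borel H])
    (phi i x * (3 * `|(x : H) - c i| ^+ 2))%:E =
    (3 * cost m)%:E)%E.
  rewrite EFinM cost_sum ge0_sume_distrr; last first.
    by move=> i _; apply: integral_ge0 => x _; rewrite lee_fin mulr_ge0// sqr_ge0.
  apply: eq_bigr => i _; rewrite -ge0_integralZl//; last first.
  - by move=> x _; rewrite lee_fin mulr_ge0// sqr_ge0.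
  - by apply/measurable_EFinP; exact: continuous_measurable_borel.
  by apply: eq_integral => x _; rewrite -EFinM mulrCA.
have -> : (\sum_i \int[Pa]_x
    ((phi i \o X) x * (3 * `|(X x : H) - c i| ^+ 2))%:E = (3 * cost mu)%:E)%E.
  rewrite -E3; apply: eq_bigr => i _.
  rewrite (integral_law mX PX
    (f := fun x : borel H => (phi i x * (3 * `|(x : H) - c i| ^+ 2))%:E))//.
  by move=> x; rewrite lee_fin mulr_ge0// mulr_ge0// sqr_ge0.
have -> : (\sum_i \int[Pb]_x
    ((phi i \o Y) x * (3 * `|(Y x : H) - c i| ^+ 2))%:E = (3 * cost nu)%:E)%E.
  rewrite -E3; apply: eq_bigr => i _.
  rewrite (integral_law mY PY
    (f := fun x : borel H => (phi i x * (3 * `|(x : H) - c i| ^+ 2))%:E))//.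
  by move=> x; rewrite lee_fin mulr_ge0// mulr_ge0// sqr_ge0.
have -> : \sum_i \sum_j gam i j * (3 * `|c i - c j| ^+ 2) =
    3 * \sum_i \sum_j gam i j * `|c i - c j| ^+ 2.
  rewrite mulr_sumr; apply: eq_bigr => i _; rewrite mulr_sumr.
  by apply: eq_bigr => j _; rewrite mulrCA.
rewrite -!EFinD -!mulrDr; apply.
- apply: measurable_funX; apply: measurable_dist => //; exact: measurableT_comp.
- by move=> z; exact: sqr_ge0.
- by move=> i; apply: (measurableT_comp (mc i)).
- by move=> i; apply: (measurableT_comp (mc i)).
- by move=> i x; rewrite mulr_ge0// sqr_ge0.
- by move=> i x; rewrite mulr_ge0// sqr_ge0.
- by move=> i j; rewrite mulr_ge0// sqr_ge0.
move=> i j x y /=.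
have : `|(X x : H) - (Y y : H)| <= `|(X x : H) - c i| + `|c i - c j| + `|(Y y : H) - c j|.
  rewrite (le_trans (ler_distD (c i) _ _))// -addrA lerD2l.
  by rewrite (le_trans (ler_distD (c j) _ _))// [`|_ - (Y y : H)|]distrC.
move: (normr_ge0 ((X x : H) - (Y y : H))) (normr_ge0 ((X x : H) - c i))
  (normr_ge0 (c i - c j)) (normr_ge0 ((Y y : H) - c j)).
move: `|(X x : H) - (Y y : H)| `|(X x : H) - c i| `|c i - c j| `|(Y y : H) - c j|.
move=> p q r s p0 q0 r0 s0 pqrs.
apply: (@le_trans _ _ ((q + r + s) ^+ 2)); first by rewrite ler_sqr ?nnegrE ?addr_ge0.
by have := sqr_ge0 (q - r); have := sqr_ge0 (r - s); have := sqr_ge0 (q - s); nra.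
Qed.

End gluing.

(** * Properties of [W2] that follow from single couplings *)

Section wasserstein.
Context (R : realType) (H : normedModType R) (sepH : separable H).
Implicit Types (mu nu rho : P2 H).

Local Notation HH := (borel H * borel H)%type.

Definition transport_cost (pi : probability HH R) : \bar R :=
  (\int[pi]_z (`|(z.1 : H) - (z.2 : H)| ^+ 2)%:E)%E.

Lemma measurable_dist_fst_snd :
  measurable_fun [set: HH] (fun z : HH => `|(z.1 : H) - (z.2 : H)| : R).
Proof. exact: measurable_dist. Qed.

Lemma measurable_cost :
  measurable_fun [set: HH] (fun z : HH => (`|(z.1 : H) - (z.2 : H)| ^+ 2)%:E).
Proof.
by apply/measurable_EFinP; apply: measurable_funX; exact: measurable_dist_fst_snd.
Qed.

Lemma W2_ge0 mu nu : (0 <= W2 mu nu)%E.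
Proof. exact: sqrte_ge0. Qed.

Lemma sqrte_EFin_sqr (r : R) : 0 <= r -> sqrte (r ^+ 2)%:E = r%:E.
Proof. by move=> r0; rewrite EFin_expe sqrte_sqr gee0_abs ?lee_fin. Qed.

Lemma W2_le mu nu (pi : probability HH R) (r : R) : 0 <= r ->
  coupling mu nu pi -> (transport_cost pi <= (r ^+ 2)%:E)%E -> (W2 mu nu <= r%:E)%E.
Proof.
move=> r0 cpi pir; rewrite -(sqrte_EFin_sqr r0) /W2 lee_sqrt ?lee_fin ?sqr_ge0//.
by apply: le_trans pir; apply: ereal_inf_lbound; exists pi.
Qed.

Lemma W2_lt mu nu (r : R) : 0 < r -> (W2 mu nu < r%:E)%E ->
  exists2 pi : probability HH R,
    coupling mu nu pi & (transport_cost pi <= (r ^+ 2)%:E)%E.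
Proof.
move=> r0; rewrite -(sqrte_EFin_sqr (ltW r0)) /W2 ltNge lee_sqrt; last first.
  apply: le_ereal_inf_tmp => _ [pi _ <-]; apply: integral_ge0 => z _.
  by rewrite lee_fin sqr_ge0.
by rewrite -ltNge => /ereal_inf_lt[_ [pi cpi <-] /ltW lt]; exists pi.
Qed.

Lemma le_W2 mu nu (x : \bar R) :
  (forall r : R, 0 < r -> (W2 mu nu < r%:E)%E -> (x <= r%:E)%E) -> (x <= W2 mu nu)%E.
Proof.
move=> h; have := W2_ge0 mu nu; case: (W2 mu nu) h => [w|_ _|//]; last exact: leey.
move=> h; rewrite lee_fin => w0; apply/lee_addgt0Pr => e e0.
by rewrite -EFinD; apply: h; rewrite ?lte_fin; lra.
Qed.

Lemma coupling_integral1 mu nu (pi : probability HH R) (f : borel H -> \bar R) :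
  coupling mu nu pi -> measurable_fun [set: borel H] f -> (forall x, (0 <= f x)%E) ->
  (\int[pi]_z f z.1 = \int[mu]_x f x)%E.
Proof.
move=> [pi1 _] mf f0; apply: (@integral_law _ _ HH (borel H) R pi mu fst f) => //.
by move=> A mA; rewrite preimage_fstE pi1.
Qed.

Lemma coupling_integral2 mu nu (pi : probability HH R) (f : borel H -> \bar R) :
  coupling mu nu pi -> measurable_fun [set: borel H] f -> (forall x, (0 <= f x)%E) ->
  (\int[pi]_z f z.2 = \int[nu]_x f x)%E.
Proof.
move=> [_ pi2] mf f0; apply: (@integral_law _ _ HH (borel H) R pi nu snd f) => //.
by move=> A mA; rewrite preimage_sndE pi2.
Qed.

Lemma image_coupling d (T : measurableType d) (P : probability T R)
    (X Y : T -> borel H) mu nu :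
  measurable_fun [set: T] X -> measurable_fun [set: T] Y ->
  (forall A, measurable A -> P (X @^-1` A) = mu A) ->
  (forall A, measurable A -> P (Y @^-1` A) = nu A) ->
  exists2 pi : probability HH R, coupling mu nu pi &
    transport_cost pi = (\int[P]_w (`|(X w : H) - (Y w : H)| ^+ 2)%:E)%E.
Proof.
move=> mX mY PX PY.
have mXY : measurable_fun [set: T] (fun w => (X w, Y w)) by exact: measurable_fun_pair.
have [pi piE] := image_probability P mXY; exists pi.
  split=> A mA; rewrite piE; [|exact: measurableX| |exact: measurableX].
  - by rewrite -PX//; congr (P _); apply/seteqP; split => w //= [].
  - by rewrite -PY//; congr (P _); apply/seteqP; split => w //= [].
rewrite /transport_cost.
rewrite -(@integral_law _ _ T HH R P pi _
  (fun z : HH => (`|(z.1 : H) - (z.2 : H)| ^+ 2)%:E) mXY)//.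
- by move=> A mA; rewrite piE.
- exact: measurable_cost.
Qed.

Lemma W2_sym mu nu : W2 mu nu = W2 nu mu.
Proof.
suff le mu' nu' : (W2 mu' nu' <= W2 nu' mu')%E by apply/eqP; rewrite eq_le !le.
apply: le_W2 => r r0 /(W2_lt r0)[pi [pi1 pi2] pir].
have [||||pi' cpi' pi'E] := @image_coupling _ _ pi snd fst mu' nu'.
- exact: measurable_snd.
- exact: measurable_fst.
- by move=> A mA; rewrite preimage_sndE pi2.
- by move=> A mA; rewrite preimage_fstE pi1.
apply: (W2_le (ltW r0) cpi'); rewrite pi'E (le_trans _ pir)//.
by under eq_integral do rewrite distrC.
Qed.

Lemma W2_measure_eq mu nu : P2_eq mu nu -> W2 mu nu = 0%E.
Proof.
move=> munu; apply/eqP; rewrite eq_le W2_ge0 andbT.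
have [||||pi cpi piE] := @image_coupling _ _ mu idfun idfun mu nu.
- exact: measurable_id.
- exact: measurable_id.
- by [].
- exact: munu.
apply: (W2_le (lexx 0) cpi); rewrite piE.
under eq_integral do rewrite subrr normr0 expr0n.
by rewrite integral0 expr0n.
Qed.

(** The independent coupling has finite cost, as |x - y|^2 <= 2 |x|^2 + 2 |y|^2. *)
Lemma W2_lty mu nu : (W2 mu nu < +oo)%E.
Proof.
pose m (m : P2 H) : R := \int[m]_(x in [set: borel H]) `|x : H| ^+ 2.
have mE k : (m k)%:E = (\int[k]_x (`|x : H| ^+ 2)%:E)%E.
  rewrite /m /Rintegral fineK//; apply: integrable_fin_num => //.
  exact: integrable_norm2.
pose r := Num.sqrt (2 * m mu + 2 * m nu).
have m0 k : 0 <= m k by apply: Rintegral_ge0 => x _; exact: sqr_ge0.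
have mn : measurable_fun [set: borel H] (fun x : borel H => (`|x : H| ^+ 2)%:E).
  by apply/measurable_EFinP; apply: continuous_measurable_borel; exact: continuous_norm2.
suff : (W2 mu nu <= r%:E)%E by move=> /le_lt_trans; apply; exact: ltry.
have [||||pi cpi piE] := @image_coupling _ _ (mu \x nu)%E fst snd mu nu.
- exact: measurable_fst.
- exact: measurable_snd.
- move=> A mA; rewrite preimage_fstE [LHS]product_measure1E//.
  by rewrite [X in (_ * X)%E](_ : _ = 1%E) ?mule1//; exact: probability_setT.
- move=> A mA; rewrite preimage_sndE [LHS]product_measure1E//.
  by rewrite [X in (X * _)%E](_ : _ = 1%E) ?mul1e//; exact: probability_setT.
apply: (W2_le _ cpi); first exact: sqrtr_ge0.
rewrite sqr_sqrtr; last by rewrite addr_ge0// mulr_ge0.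
apply: (@le_trans _ _ (\int[pi]_z
    (2%:E * (`|z.1 : H| ^+ 2)%:E + 2%:E * (`|z.2 : H| ^+ 2)%:E))%E).
  apply: ge0_le_integral => //.
  - exact: measurable_cost.
  - apply: emeasurable_funD; apply: emeasurable_funM => //.
      exact: (measurableT_comp mn measurable_fst).
    exact: (measurableT_comp mn measurable_snd).
  move=> [x y] _ /=; rewrite -!EFinM -EFinD lee_fin.
  have : `|(x : H) - (y : H)| ^+ 2 <= (`|x : H| + `|y : H|) ^+ 2.
    by rewrite ler_sqr ?nnegrE ?addr_ge0//; exact: ler_normB.
  by have := sqr_ge0 (`|x : H| - `|y : H|); nra.
rewrite ge0_integralD//; last 2 first.
- by apply: emeasurable_funM => //; exact: (measurableT_comp mn measurable_fst).
- by apply: emeasurable_funM => //; exact: (measurableT_comp mn measurable_snd).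
rewrite !ge0_integralZl//; last 2 first.
- exact: (measurableT_comp mn measurable_snd).
- exact: (measurableT_comp mn measurable_fst).
rewrite (coupling_integral1 (f := fun x : borel H => (`|x : H| ^+ 2)%:E) cpi)//.
rewrite (coupling_integral2 (f := fun x : borel H => (`|x : H| ^+ 2)%:E) cpi)//.
by rewrite -!mE -!EFinM -EFinD.
Qed.

Lemma e22E mu (a b : H) : ((e22 mu a b) ^+ 2)%:E =
  (\int[mu]_x (Num.min `|(x : H) - a| `|(x : H) - b| ^+ 2)%:E)%E.
Proof.
have minE (x : H) : Num.min `|x - a| `|x - b| ^+ 2 =
    Num.min (`|x - a| ^+ 2) (`|x - b| ^+ 2).
  have [ab|/ltW ab] := leP `|x - a| `|x - b|.
    by rewrite min_l// ler_sqr ?nnegrE.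
  by rewrite min_r// ler_sqr ?nnegrE.
rewrite /e22 sqr_sqrtr; last first.
  by apply: Rintegral_ge0 => x _; rewrite le_min !sqr_ge0.
under [RHS]eq_integral do rewrite minE.
rewrite /Rintegral fineK//; apply: integrable_fin_num => //.
apply: (@growth2_integrable R H mu (fun x => Num.min (`|x - a| ^+ 2) (`|x - b| ^+ 2))).
  exact: continuous_min_dist2.
exact: growth2_min_dist2.
Qed.

(** The smaller of the distances to [a] and [b] is a 1-Lipschitz function with L^2 norm [e22], so
    Minkowski applies on a coupling of cost at most r^2. *)
Lemma e22_le_W2 mu nu (a b : H) (r : R) : 0 < r -> (W2 mu nu < r%:E)%E ->
  e22 mu a b <= e22 nu a b + r.
Proof.
move=> r0 /(W2_lt r0)[pi cpi pir].
pose m (x : borel H) : R := Num.min `|(x : H) - a| `|(x : H) - b|.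
have m0 x : 0 <= m x by rewrite le_min !normr_ge0.
have cn (c : H) : continuous (fun x : H => `|x - c|).
  by move=> x; apply: cvg_norm; apply: cvgB; [exact: cvg_id|exact: cvg_cst].
have mm : measurable_fun [set: borel H] m.
  apply: (@continuous_measurable_borel R H (fun x => Num.min `|x - a| `|x - b|)) => x.
  exact: (@continuous_min R H (fun x => `|x - a|) (fun x => `|x - b|)
    x (cn a x) (cn b x)).
have mm2 : measurable_fun [set: borel H] (fun x => (m x ^+ 2)%:E).
  by apply/measurable_EFinP; exact: measurable_funX.
have mm0 x : (0 <= (m x ^+ 2)%:E)%E by rewrite lee_fin sqr_ge0.
(* [l2_triangle] takes positive radii while [e22 nu a b] may be 0; hence the slack [e]. *)
apply/ler_addgt0Pr => e e0.
have ne : 0 <= e22 nu a b by exact: sqrtr_ge0.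
have ne' : 0 < e22 nu a b + e by rewrite ltr_wpDl.
have := @l2_triangle _ HH R pi (fun z => m z.2)
  (fun z => `|(z.1 : H) - (z.2 : H)|) (fun z => m z.1) (e22 nu a b + e) r.
rewrite (coupling_integral1 (f := fun x => (m x ^+ 2)%:E) cpi)//.
rewrite (coupling_integral2 (f := fun x => (m x ^+ 2)%:E) cpi)// -!e22E.
rewrite !lee_fin => L.
have er0 : 0 <= e22 nu a b + e + r by rewrite addr_ge0 ?ltW.
suff : e22 mu a b ^+ 2 <= (e22 nu a b + e + r) ^+ 2.
  rewrite ler_sqr ?nnegrE//; last exact: sqrtr_ge0.
  by rewrite -addrA (addrC e) addrA.
apply: L => //.
- exact: (measurableT_comp mm measurable_snd).
- exact: measurable_dist_fst_snd.
- exact: (measurableT_comp mm measurable_fst).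
- move=> [x y] /=; rewrite m0/= /m.
  have t c : `|(x : H) - c| <= `|(y : H) - c| + `|(x : H) - (y : H)|.
    by rewrite [leRHS]addrC ler_distD.
  by have := t a; have := t b; rewrite addr_minl le_min !ge_min => -> ->; rewrite orbT.
- by rewrite ler_sqr ?nnegrE//; [rewrite lerDl; exact: ltW|exact: ltW].
Qed.

Lemma Q22_le_W2 mu nu : (Q22 mu nu <= W2 mu nu)%E.
Proof.
apply: ge_ereal_sup => _ [[a b] _ <-] /=; apply: le_W2 => r r0 W.
have := e22_le_W2 a b r0 W; rewrite W2_sym in W; have := e22_le_W2 a b r0 W.
by rewrite lee_fin ler_norml => h1 h2; apply/andP; split; lra.
Qed.

(** Under couplings of arbitrarily small cost, almost all the mass of a closed set lands in a given
    neighbourhood of it. Shrinking the neighbourhood compares the measures on closed sets; symmetry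
    and complements give equality on open sets, a generating family stable under intersection. *)
Lemma W2_eq0_measure_eq mu nu : W2 mu nu = 0%E -> P2_eq mu nu.
Proof.
have closed_le (mu' nu' : P2 H) (A : set H) : W2 mu' nu' = 0%E -> closed A ->
    (mu' (A : set (borel H)) <= nu' (A : set (borel H)))%E.
  move=> W0 cA; have mclosed : measurable (A : set (borel H)).
    rewrite -(setCK A); apply: measurableC; apply: open_measurable_borel.
    exact: closed_openC.
  pose U (k : nat) : set H := \bigcup_(a in A) ball a k.+1%:R^-1.
  have oU k : open (U k) by apply: bigcup_open => a _; exact: ball_open.
  have mU k : measurable (U k : set (borel H)) by exact: open_measurable_borel.
  have AU : \bigcap_k U k = A.
    apply/seteqP; split => [x Ux|x Ax k _]; last first.
      by exists x => //; exact: ballxx.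
    apply: cA => B /nbhs_ballP[e e0 eB].
    have [k ke] : exists k : nat, (k.+1%:R^-1 : R) < e.
      have : (k.+1%:R^-1 : R) @[k --> \oo] --> (0 : R) by exact: cvg_harmonic.
      move=> /cvgrPdist_lt /(_ _ e0) [k _ /(_ k (leqnn _))] /=.
      by rewrite sub0r normrN ger0_norm ?invr_ge0//; exists k.
    have [a Aa ax] := Ux k I; exists a; split=> //; apply: eB.
    apply: ball_sym; exact: le_ball (ltW ke) _ ax.
  have le_U k : (mu' (A : set (borel H)) <= nu' (U k : set (borel H)))%E.
    apply/lee_addgt0Pr => e e0.
    pose del : R := k.+1%:R^-1; have del0 : 0 < del by rewrite invr_gt0.
    (* Chebyshev at distance [del] turns a cost r^2 into an exceptional mass at most r^2 / del^2 =
       e. *)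
    pose r := Num.sqrt (del ^+ 2 * e).
    have r0 : 0 < r by rewrite sqrtr_gt0 mulr_gt0// exprn_gt0.
    have rE : r ^+ 2 = del ^+ 2 * e by rewrite sqr_sqrtr// mulr_ge0 ?sqr_ge0 ?ltW.
    have [|pi [pi1 pi2] pir] := @W2_lt mu' nu' r r0; first by rewrite W0 lte_fin.
    pose E : set HH := (fun z : HH => `|(z.1 : H) - (z.2 : H)|) @^-1` `[del, +oo[.
    have mE : measurable E.
      rewrite -[E]setTI; apply: measurable_dist_fst_snd => //.
    have EA : A `*` setT `<=` (setT `*` (U k : set (borel H))) `|` E.
      move=> [x y] [/= Ax _]; have [xy|xy] := ltP `|x - y| del.
        by left; split => //=; exists x => //; rewrite -ball_normE.
      by right; rewrite /E/= in_itv/= andbT.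
    have piE : (pi E <= e%:E)%E.
      have : ((del ^+ 2)%:E * pi E <= (del ^+ 2)%:E * e%:E)%E.
        rewrite -EFinM -rE (le_trans _ pir)// -[E]setIT -integral_indic//.
        rewrite -ge0_integralZl//; last 2 first.
        - by apply/measurable_EFinP; exact: measurable_indic.
        - by rewrite lee_fin sqr_ge0.
        apply: ge0_le_integral => //.
        - by move=> z _; rewrite -EFinM lee_fin mulr_ge0// sqr_ge0.
        - apply: emeasurable_funM => //; apply/measurable_EFinP.
          exact: measurable_indic.
        - exact: measurable_cost.
        move=> z _; rewrite -EFinM lee_fin indicE.
        case: (boolP (z \in E)) => [|_]; last by rewrite mulr0 sqr_ge0.
        rewrite inE /E/= in_itv/= andbT mulr1 => dz.
        by rewrite ler_sqr ?nnegrE// ltW.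
      by rewrite lee_pmul2l// ?lte_fin ?exprn_gt0.
    rewrite -pi1// -pi2//.
    apply: (@le_trans _ _ (pi ((setT `*` (U k : set (borel H))) `|` E))).
      apply: le_measure => //; rewrite inE; first exact: measurableX.
      by apply: measurableU => //; exact: measurableX.
    apply: (le_trans (measureU2 _ _ _)) => //; first exact: measurableX.
    by rewrite leeD2l.
  have cU : (nu' (U k : set (borel H)) @[k --> \oo] --> nu' (A : set (borel H)))%E.
    rewrite -AU; apply: nonincreasing_cvg_mu => //.
    - by rewrite (le_lt_trans (probability_le1 _ _))// ltry.
    - by apply: bigcap_measurable.
    move=> i j ij; apply/subsetPset => x [a Aa ax]; exists a => //.
    by apply: le_ball ax; rewrite lef_pV2 ?posrE// ler_nat ltnS.
  rewrite -(cvg_lim _ cU)//; apply: lime_ge.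
    by apply/cvg_ex; exists (nu' (A : set (borel H))).
  by apply: nearW => k; exact: le_U.
move=> W0; have W0' : W2 nu mu = 0%E by rewrite W2_sym.
have closed_eq (A : set H) : closed A -> mu (A : set (borel H)) = nu (A : set (borel H)).
  by move=> cA; apply/eqP; rewrite eq_le !closed_le.
move=> A mA; apply: (@measure_unique _ R (borel H) (@open H) (fun=> setT)) => //.
- exact: openI.
- by move=> _; exact: openT.
- by rewrite bigcup_const//; exists 0%N.
- move=> B oB; have mB := open_measurable_borel oB.
  have sub_inj (x y : \bar R) : x \is a fin_num -> y \is a fin_num ->
      (1 - x = 1 - y)%E -> x = y.
    by case: x y => [x| |] [y| |] // _ _; rewrite -!EFinB => -[xy]; congr (_%:E); lra.
  apply: sub_inj; [exact: fin_num_measure|exact: fin_num_measure|].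
  have := closed_eq (~` B) (open_closedC oB).
  by rewrite [LHS]probability_setC// [RHS]probability_setC.
- by move=> _; exact: (le_lt_trans (probability_le1 mu measurableT) (ltry _)).
Qed.

End wasserstein.

(** * Couplings of two finite mass vectors *)

Section coupling_matrix.
Context (R : realType) (I : finType).

(** The common part min (p i, q i) stays on the diagonal, and the excesses [r] and [s], of equal
    total [S], are matched proportionally. If [S] is 0 both excesses vanish, in agreement with x / 0
    = 0. *)
Lemma coupling_matrix (p q : I -> R) : (forall i, 0 <= p i) ->
  (forall i, 0 <= q i) -> \sum_i p i = \sum_i q i ->
  exists gam : I -> I -> R, [/\ forall i j, 0 <= gam i j,
    forall i, \sum_j gam i j = p i, forall j, \sum_i gam i j = q j &
    forall i j, i != j -> gam i j <= `|p i - q i|].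
Proof.
move=> p0 q0 pq.
pose m i := Num.min (p i) (q i).
have m0 i : 0 <= m i by rewrite le_min p0 q0.
pose r i := p i - m i; pose s i := q i - m i.
have r0 i : 0 <= r i by rewrite subr_ge0 ge_min lexx.
have s0 i : 0 <= s i by rewrite subr_ge0 ge_min lexx orbT.
pose S := \sum_i r i.
have SE : S = \sum_i s i by rewrite /S /r /s !sumrB pq.
have S0 : 0 <= S by apply: sumr_ge0.
have rS i : r i * (S / S) = r i.
  have [S00|S00] := eqVneq S 0; last by rewrite divff// mulr1.
  suff -> : r i = 0 by rewrite mul0r.
  apply/eqP; rewrite eq_le r0 -S00 andbT.
  by rewrite /S (bigD1 i)//= lerDl; apply: sumr_ge0.
have sS i : s i * (S / S) = s i.
  have [S00|S00] := eqVneq S 0; last by rewrite divff// mulr1.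
  suff -> : s i = 0 by rewrite mul0r.
  apply/eqP; rewrite eq_le s0 -S00 andbT.
  by rewrite SE (bigD1 i)//= lerDl; apply: sumr_ge0.
exists (fun i j => (i == j)%:R * m i + r i * (s j / S)); split.
- move=> i j; apply: addr_ge0; first by rewrite mulr_ge0.
  by apply: mulr_ge0 => //; exact: divr_ge0.
- move=> i; rewrite big_split/= -mulr_sumr -mulr_suml -SE rS.
  rewrite (bigD1 i)//= eqxx mul1r big1 ?addr0.
    by rewrite /r addrC subrK.
  by move=> j /negPf ji; rewrite eq_sym ji mul0r.
- move=> j; rewrite big_split/= -mulr_suml -/S mulrCA sS.
  rewrite (bigD1 j)//= eqxx mul1r big1 ?addr0.
    by rewrite /s addrC subrK.
  by move=> i /negPf ij; rewrite ij mul0r.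
- move=> i j /negPf ->; rewrite mul0r add0r.
  apply: (@le_trans _ _ (r i)).
    apply: ler_piMr => //; have [S00|S00] := eqVneq S 0.
      by rewrite S00 invr0 mulr0.
    rewrite ler_pdivrMr ?mul1r; last by rewrite lt0r S00.
    by rewrite SE (bigD1 j)//= lerDl; apply: sumr_ge0.
  rewrite /r /m; have [pqi|qpi] := leP (p i) (q i); first by rewrite subrr.
  exact: ler_norm.
Qed.

End coupling_matrix.

(** * Triangle inequality for [W2] and convergence in [W2] *)

Section wasserstein_hilbert.
Context (R : realType) (H : normedModType R) (inner : {dot H for idfun}).
Hypothesis innerE : forall x : H, inner x x = `|x| ^+ 2.
Hypothesis sepH : separable H.
Implicit Types (mu nu rho : P2 H).

Local Notation HH := (borel H * borel H)%type.

(** The two couplings are joined along middle points that are close in L^2 instead of equal: the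
    diagonal matrix puts both middle points in the same soft cell. *)
Lemma W2_triangle mu nu rho : (W2 mu rho <= W2 mu nu + W2 nu rho)%E.
Proof.
have := W2_lty sepH mu nu; have := W2_ge0 mu nu.
have := W2_lty sepH nu rho; have := W2_ge0 nu rho.
case Eb : (W2 nu rho) => [b| |]//; rewrite lee_fin => b0 _.
case Ea : (W2 mu nu) => [a| |]//; rewrite lee_fin => a0 _.
rewrite -EFinD; apply/lee_addgt0Pr => e e0; rewrite -EFinD.
(* One [t] for each near-optimal coupling and one for the jump between the middle points. *)
pose t := e / 3; have t0 : 0 < t by rewrite divr_gt0.
have [||pi cpi pir] := @W2_lt R H mu nu (a + t); [lra|by rewrite Ea lte_fin; lra|].
have [||pi' cpi' pir'] := @W2_lt R H nu rho (b + t); [lra|by rewrite Eb lte_fin; lra|].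
(* The gluing bound is 3 (cost + 0 + cost), the cross term vanishing for a diagonal matrix; hence
   6. *)
have eta0 : 0 < t ^+ 2 / 6 by rewrite divr_gt0// exprn_gt0.
have [I [phi [c [phi0 phi1 phiS phicost]]]] :=
  partition_of_unity innerE sepH nu eta0.
have phic i : continuous (phi i).
  apply: (phiS [set f | continuous f]) => [x|f k w cf] /=; first exact: cvg_cst.
  exact: continuous_mul_trig_factor.
have [|||||||G [G1 G2 GE]] := @gluing R H sepH I phi c phic phi0 phi1 _ _ HH HH pi pi'
  snd fst nu nu (fun i j => (i == j)%:R * \int[nu]_(x in [set: borel H]) phi i x).
- exact: measurable_snd.
- exact: measurable_fst.
- by move=> A mA; rewrite preimage_sndE; apply: cpi.2.
- by move=> A mA; rewrite preimage_fstE; apply: cpi'.1.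
- by move=> i j; rewrite mulr_ge0// Rintegral_ge0.
- move=> i; rewrite (bigD1 i)//= eqxx mul1r big1 ?addr0// => j /negPf ji.
  by rewrite eq_sym ji mul0r.
- move=> j; rewrite (bigD1 j)//= eqxx mul1r big1 ?addr0// => i /negPf ij.
  by rewrite ij mul0r.
have {}GE : (\int[G]_z (`|(z.1.2 : H) - (z.2.1 : H)| ^+ 2)%:E <= (t ^+ 2)%:E)%E.
  apply: (le_trans GE); rewrite lee_fin big1 ?addr0; last first.
    move=> i _; rewrite big1// => j _; have [->|ij] := eqVneq i j.
      by rewrite subrr normr0 expr0n mulr0.
    by rewrite mul0r mul0r.
  by move: phicost; rewrite /cost; lra.
have m11 : measurable_fun [set: HH * HH] (fun z : HH * HH => z.1.1).
  exact: (measurableT_comp measurable_fst measurable_fst).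
have m12 : measurable_fun [set: HH * HH] (fun z : HH * HH => z.1.2).
  exact: (measurableT_comp measurable_snd measurable_fst).
have m21 : measurable_fun [set: HH * HH] (fun z : HH * HH => z.2.1).
  exact: (measurableT_comp measurable_fst measurable_snd).
have m22 : measurable_fun [set: HH * HH] (fun z : HH * HH => z.2.2).
  exact: (measurableT_comp measurable_snd measurable_snd).
have [||||kap ckap kapE] := @image_coupling R H sepH _ (HH * HH)%type G
  (fun z => z.1.1) (fun z => z.2.2) mu rho => //.
- move=> A mA; rewrite -(cpi.1 _ mA) -[RHS]G1; last exact: measurableX.
  by congr (G _); apply/seteqP; split=> -[[x y] [x' y']] //= [[]].
- move=> A mA; rewrite -(cpi'.2 _ mA) -[RHS]G2; last exact: measurableX.
  by congr (G _); apply/seteqP; split=> -[[x y] [x' y']] //= [_ []].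
have md : measurable_fun [set: HH] (fun z : HH => (`|(z.1 : H) - (z.2 : H)| ^+ 2)%:E).
  exact: measurable_cost.
have G11 : (\int[G]_z (`|(z.1.1 : H) - (z.1.2 : H)| ^+ 2)%:E <= ((a + t) ^+ 2)%:E)%E.
  rewrite (@integral_law _ _ (HH * HH)%type HH R G pi fst
    (fun z : HH => (`|(z.1 : H) - (z.2 : H)| ^+ 2)%:E))//.
  by move=> A mA; rewrite preimage_fstE G1.
have G22 : (\int[G]_z (`|(z.2.1 : H) - (z.2.2 : H)| ^+ 2)%:E <= ((b + t) ^+ 2)%:E)%E.
  rewrite (@integral_law _ _ (HH * HH)%type HH R G pi' snd
    (fun z : HH => (`|(z.1 : H) - (z.2 : H)| ^+ 2)%:E))//.
  by move=> A mA; rewrite preimage_sndE G2.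
have G12 : (\int[G]_z (`|(z.1.1 : H) - (z.2.1 : H)| ^+ 2)%:E <= ((a + t + t) ^+ 2)%:E)%E.
  apply: (@l2_triangle _ (HH * HH)%type R G (fun z => `|(z.1.1 : H) - (z.1.2 : H)|)
    (fun z => `|(z.1.2 : H) - (z.2.1 : H)|)) => //; try exact: measurable_dist.
  - by move=> z; rewrite normr_ge0/=; exact: ler_distD.
  - lra.
apply: (@W2_le R H mu rho kap (a + b + e)) => //; first by lra.
rewrite kapE (_ : a + b + e = (a + t + t) + (b + t)); last by rewrite /t; field.
apply: (@l2_triangle _ (HH * HH)%type R G (fun z => `|(z.1.1 : H) - (z.2.1 : H)|)
    (fun z => `|(z.2.1 : H) - (z.2.2 : H)|)) => //; try exact: measurable_dist.
- by move=> z; rewrite normr_ge0/=; exact: ler_distD.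
- lra.
- lra.
Qed.

Lemma W2_limit (F : set_system (P2 H)) (FF : Filter F) mu :
  (forall a b : H, e22 nu a b @[nu --> F] --> e22 mu a b) ->
  forall r : R, 0 < r -> \forall nu \near F, (W2 mu nu < r%:E)%E.
Proof.
move=> e22_cvg r r0.
pose t := r / 2; have t0 : 0 < t by rewrite divr_gt0.
(* Here 12 = 3 (1 + 1 + 2): [eta] for the cost of [mu], [eta] for the cross term, and 2 [eta] for
   the cost of [nu], which differs from that of [mu] by at most [eta]. *)
pose eta := t ^+ 2 / 12; have eta0 : 0 < eta by rewrite divr_gt0// exprn_gt0.
have [I [phi [c [phi0 phi1 phiS phicost]]]] :=
  partition_of_unity innerE sepH mu eta0.
have phic i : continuous (phi i).
  apply: (phiS [set f | continuous f]) => [x|f k w cf] /=; first exact: cvg_cst.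
  exact: continuous_mul_trig_factor.
have phitrig i : trig_test inner F mu (phi i).
  apply: (phiS [set f | trig_test inner F mu f]) => [|f k w tf] /=.
    exact: trig_test1.
  exact: trig_test_factor.
have phi_le i x : `|phi i x| <= 1 by rewrite ger0_norm//; exact: phi_le1.
have test_cost : test_function F mu (fun x => \sum_i phi i x * `|x - c i| ^+ 2).
  have -> : (fun x => \sum_i phi i x * `|x - c i| ^+ 2) = fun x => `|x - 0| ^+ 2 +
      \sum_i (- 2 * (phi i x * inner x (c i)) + `|c i| ^+ 2 * phi i x).
    apply/funext => x; rewrite subr0.
    rewrite (_ : `|x| ^+ 2 = \sum_i phi i x * `|x| ^+ 2); last first.
      by rewrite -mulr_suml phi1 mul1r.
    by rewrite -big_split/=; apply: eq_bigr => i _; rewrite (norm2B innerE); ring.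
  apply: testD; first exact: test_norm2.
  apply: test_sum => i _; apply: testD; apply: testZ; last exact: trig_test_test.
  exact: trig_test_inner.
have [_ _ /cvgrPdist_le/(_ _ eta0) cost_near] := test_cost.
pose D : R := \sum_i \sum_j `|c i - c j| ^+ 2.
have D0 : 0 <= D by apply: sumr_ge0 => i _; apply: sumr_ge0 => j _; exact: sqr_ge0.
(* Off-diagonal entries of [gam] will be at most [kap], so the cross term is at most kap * D <=
   eta. *)
pose kap := eta / (1 + D).
have kap0 : 0 < kap by rewrite divr_gt0// ltr_pwDl.
have phi_near : \forall nu \near F, forall i,
    `|\int[mu]_(x in [set: borel H]) phi i x -
      \int[P2_prob nu]_(x in [set: borel H]) phi i x| <= kap.
  apply: filter_forall => i.
  by have [_ _ /cvgrPdist_le/(_ _ kap0)] := trig_test_test (phitrig i).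
near=> nu.
have Hc : `|cost phi c mu - cost phi c nu| <= eta by near: nu.
have Hp : forall i, `|\int[mu]_(x in [set: borel H]) phi i x -
  \int[nu]_(x in [set: borel H]) phi i x| <= kap by near: nu.
have p0 k i : 0 <= \int[P2_prob k]_(x in [set: borel H]) phi i x.
  by apply: Rintegral_ge0.
have sum1 (k : P2 H) : \sum_i \int[k]_(x in [set: borel H]) phi i x = 1.
  apply: EFin_inj; rewrite -sumEFin.
  have kE i : (\int[k]_(x in [set: borel H]) phi i x)%:E = (\int[k]_x (phi i x)%:E)%E.
    rewrite /Rintegral fineK//; apply: integrable_fin_num => //.
    exact: (growth2_integrable k (@phic i) (growth2_phi phi0 phi1 i)).
  under eq_bigr do rewrite kE.
  rewrite -ge0_integral_sum//; last 2 first.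
  - by move=> i; apply/measurable_EFinP; exact: continuous_measurable_borel.
  - by move=> i x _; rewrite lee_fin.
  under eq_integral do rewrite sumEFin phi1.
  by rewrite integral_cst//= mul1e; exact: probability_setT.
have [gam [gam0 gamp gamq gamle]] := coupling_matrix (p0 mu) (p0 nu)
  (etrans (sum1 mu) (esym (sum1 nu))).
have [|||||||pi [pi1 pi2 piE]] := @gluing R H sepH I phi c phic phi0 phi1 _ _
  (borel H) (borel H) mu nu idfun idfun mu nu gam => //;
  [exact: measurable_id|exact: measurable_id|].
suff : (W2 mu nu <= t%:E)%E.
  by move=> h; apply: (le_lt_trans h); rewrite lte_fin /t; lra.
apply: (W2_le (ltW t0) (conj pi1 pi2)); apply: (le_trans piE); rewrite lee_fin.
have : \sum_i \sum_j gam i j * `|c i - c j| ^+ 2 <= eta.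
  apply: (@le_trans _ _ (kap * D)).
    rewrite mulr_sumr; apply: ler_sum => i _; rewrite mulr_sumr; apply: ler_sum => j _.
    have [->|ij] := eqVneq i j; first by rewrite subrr normr0 expr0n !mulr0.
    by rewrite ler_wpM2r ?sqr_ge0// (le_trans (gamle _ _ ij)).
  by rewrite /kap mulrAC ler_pdivrMr ?ltr_pwDl// ler_pM2l// lerDr.
move: phicost; rewrite -/(cost phi c mu).
move: Hc; rewrite ler_norml => /andP[].
have : 12 * eta = t ^+ 2 by rewrite /eta mulrC divfK.
move: (cost phi c mu) (cost phi c nu) (\sum_i _) => x y z.
lra.
Unshelve. all: by end_near. Qed.

Lemma Q22_ub mu nu (a b : H) : (`|e22 mu a b - e22 nu a b|%:E <= Q22 mu nu)%E.
Proof. by apply: ereal_sup_ubound; exists (a, b). Qed.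

Lemma Q22_ge0 mu nu : (0 <= Q22 mu nu)%E.
Proof. by apply: le_trans (Q22_ub mu nu 0 0); rewrite lee_fin. Qed.

Lemma Q22_eq0 mu nu : Q22 mu nu = 0%E -> P2_eq mu nu.
Proof.
move=> Q0; apply: (W2_eq0_measure_eq sepH).
have e22_eq a b : e22 nu a b = e22 mu a b.
  have := Q22_ub mu nu a b; rewrite Q0 lee_fin normr_le0 subr_eq0.
  by move=> /eqP.
(* Along the filter of sets containing [nu], equality of all [e22] is convergence, and the limit
   statement then speaks of [nu] itself. *)
have FF : Filter (globally [set nu]) by exact: globally_filter.
have /(W2_limit FF) lim : forall a b : H,
    e22 k a b @[k --> globally [set nu]] --> e22 mu a b.
  move=> a b; apply/cvgrPdist_le => e e0 k /= ->.
  by rewrite e22_eq subrr normr0 ltW.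
have {}lim r : 0 < r -> (W2 mu nu < r%:E)%E.
  by move=> r0; exact: (lim r r0 nu erefl).
apply/eqP; rewrite eq_le W2_ge0 andbT; apply/lee_addgt0Pr => e e0.
by rewrite add0e ltW// lim.
Qed.

End wasserstein_hilbert.

Theorem corollary3p1 (R : realType) (H : completeNormedModType R)
    (inner : {dot H for idfun})
    (innerE : forall x : H, inner x x = `|x| ^+ 2)
    (sepH : separable H) :
  [/\ is_distance (@P2_eq R H) (@Q22 R H),
      is_distance (@P2_eq R H) (@W2 R H) &
      topologically_equivalent (@Q22 R H) (@W2 R H)].
Proof.
split.
- split=> [mu nu|mu nu|mu nu|mu nu|mu nu rho].
  + exact: Q22_ge0.
  + exact: (le_lt_trans (Q22_le_W2 sepH mu nu) (W2_lty sepH mu nu)).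
  + split=> [|munu]; first exact: (Q22_eq0 innerE sepH).
    apply/eqP; rewrite eq_le Q22_ge0 andbT (le_trans (Q22_le_W2 sepH mu nu))//.
    by rewrite (W2_measure_eq sepH munu).
  + by congr ereal_sup; apply: eq_imagel => -[a b] _ /=; rewrite distrC.
  + apply: ge_ereal_sup => _ [[a b] _ <-] /=.
    apply: (@le_trans _ _ (`|e22 mu a b - e22 nu a b|%:E +
        `|e22 nu a b - e22 rho a b|%:E)%E).
      by rewrite -EFinD lee_fin; exact: ler_distD.
    by apply: leeD; exact: Q22_ub.
- split=> [mu nu|mu nu|mu nu|mu nu|mu nu rho].
  + exact: W2_ge0.
  + exact: W2_lty.
  + by split; [exact: W2_eq0_measure_eq|exact: W2_measure_eq].
  + exact: W2_sym.
  + exact: (W2_triangle innerE sepH).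
(* A [Q22]-open set is [W2]-open, since the [W2]-ball lies in the [Q22]-ball of the same radius. *)
apply/seteqP; split=> U openU mu Umu.
  have [r r0 rU] := openU mu Umu; exists r => // nu /= W; apply: rU => /=.
  exact: (le_lt_trans (Q22_le_W2 sepH mu nu) W).
have [r r0 rU] := openU mu Umu.
(* Along the filter generated by the [Q22]-balls at [mu] every [e22] converges, so some [Q22]-ball
   lies in the given [W2]-ball. *)
pose F := filter_from [set e : R | 0 < e] (fun e => [set nu | (Q22 mu nu < e%:E)%E]).
have FF : Filter F.
  apply: filter_from_filter; first by exists 1; exact: ltr01.
  move=> e1 e2 /= e10 e20; exists (Num.min e1 e2); first by rewrite /= lt_min e10.
  by move=> nu /=; rewrite EFin_min lt_min => /andP[].
have [|e e0 eW] := W2_limit innerE sepH FF (mu := mu) _ r0.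
  move=> a b; apply/cvgrPdist_le => e e0; exists e => // nu /= Q.
  by rewrite -lee_fin (le_trans (Q22_ub mu nu a b))// ltW.
by exists e => // nu /= Q; apply: rU => /=; exact: eW.
Qed.
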